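(* In both the topological and the approach case, $(D,S,\eta,\varepsilon)$ defines a dual adjunction $\mathsf{Top}^{\mathrm{op}}\leftrightarrows\mathsf{CDTop}$, respectively $\mathsf{App}^{\mathrm{op}}\leftrightarrows\mathsf{CDApp}$. That is: $D\colon\mathsf{Top}^{\mathrm{op}}\to\mathsf{CDTop}$ and $S\colon\mathsf{CDTop}\to\mathsf{Top}^{\mathrm{op}}$ (respectively $D\colon\mathsf{App}^{\mathrm{op}}\to\mathsf{CDApp}$ and $S\colon\mathsf{CDApp}\to\mathsf{App}^{\mathrm{op}}$) are functors, $\eta\colon 1\to SD$ (on $\mathsf{Top}$, respectively $\mathsf{App}$) and $\varepsilon\colon 1\to DS$ (on $\mathsf{CDTop}$, respectively $\mathsf{CDApp}$) are natural transformations, and $S(\varepsilon_L)\cdot\eta_{SL}=1_{SL}$ and $D(\eta_X)\cdot\varepsilon_{DX}=1_{DX}$ for all objects $L$ and all spaces $X$.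
   Context: Two parallel cases are treated. Topological case: $\mathsf V=\{\mathrm{false},\mathrm{true}\}=\{0,1\}$, $\otimes=\&$, $k=\mathrm{true}$, $\mathrm{false}\sqsubseteq\mathrm{true}$. Approach case: $\mathsf V=[0,\infty]$, $\otimes=+$, $k=0$, $u\sqsubseteq v$ iff $u\ge v$ numerically (so joins $\bigvee$ in $\mathsf V$ are numerical infima and meets $\bigwedge$ are numerical suprema). A $\mathsf V$-relation $r\colon X\nrightarrow Y$ is a function $X\times Y\to\mathsf V$; composition is $(s\cdot r)(x,z)=\bigvee_y r(x,y)\otimes s(y,z)$; $r^\circ(y,x)=r(x,y)$; $\mathsf V$-relations are ordered pointwise by $\sqsubseteq$; a function is viewed as the $\mathsf V$-relation given by its graph (true $\mapsto k$, false $\mapsto$ bottom of $\mathsf V$). $UX$ is the set of ultrafilters on $X$, $Uf$ the image-ultrafilter map, $e_X(x)$ the principal ultrafilter at $x$, $m_X\colon UUX\to UX$, $m_X(\mathfrak X)=\{A\subseteq X\mid A^\#\in\mathfrak X\}$ with $A^\#=\{\mathfrak x\in UX\mid A\in\mathfrak x\}$. For $r\colon X\nrightarrow Y$, $Ur(\mathfrak x,\mathfrak y)=\bigwedge_{A\in\mathfrak x,B\in\mathfrak y}\bigvee_{x\in A,y\in B}r(x,y)$. A space is a pair $(X,a)$ with $a\colon UX\nrightarrow X$, $e_X^\circ\sqsubseteq a$ and $a\cdot Ua\cdot m_X^\circ\sqsubseteq a$; in the topological case these are exactly the topological spaces with their ultrafilter convergence, in the approach case these are the approach spaces. A map $f\colon(X,a)\to(Y,b)$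 of spaces is a function with $a(\mathfrak x,x)\sqsubseteq b(Uf(\mathfrak x),f(x))$ (continuous, respectively contraction, map). The categories are $\mathsf{Top}$ and $\mathsf{App}$. Maps are ordered by $f\le g$ iff $k\sqsubseteq b(e_Y(f(x)),g(x))$ for all $x$; $f\cong g$ means $f\le g$ and $g\le f$; $f\dashv g$ means $1\le g\cdot f$ and $f\cdot g\le 1$. The underlying order of $X$ is $x\le y$ iff $k\sqsubseteq a(e_X(x),y)$; $X$ is T$_0$ if this order is anti-symmetric. $X\otimes Y$ is $X\times Y$ with structure $c(\mathfrak w,(x,y))=a(U\pi_1(\mathfrak w),x)\otimes b(U\pi_2(\mathfrak w),y)$. $\mathsf V$ is a space: the Sierpiński space with $\{1\}$ closed, respectively $[0,\infty]$ with $\lambda(\mathfrak u,x)=\max\{x-\xi(\mathfrak u),0\}$ (with $\infty-\infty=0$), $\xi(\mathfrak u)=\sup_{A\in\mathfrak u}\inf A$. A $\mathsf U$-relation $r\colon X\rightharpoonup Y$ is a $\mathsf V$-relation $UX\nrightarrow Y$; Kleisli composition is $s\circ r=s\cdot Ur\cdot m_X^\circ$. A $\mathsf U$-module $\varphi\colon(X,a)\rightharpoonup(Y,b)$ is a $\mathsf U$-relation with $\varphi\circ a=\varphi$ and $b\circ\varphi=\varphi$; spaces and $\mathsf U$-modules form an ordered category with identities $a$. Each map $f\colon X\to Y$ gives $\mathsf U$-modules $f_*\colon X\rightharpoonup Y$, $f_*(\mathfrak x,y)=b(Uf(\mathfrak x),y)$, and $f^*\colon Y\rightharpoonup X$, $f^*(\mathfrak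 y,x)=b(\mathfrak y,f(x))$. For $x\in X$, $x^*=a(-,x)\colon X\rightharpoonup 1$, where $1$ is the one-point space. $X^{\mathrm{op}}$ is the space on $UX$ with structure $(\mathfrak X,\mathfrak x)\mapsto(Ua\cdot m_X^\circ)(\mathfrak x,m_X(\mathfrak X))$. $PX$ is the set of $\mathsf U$-modules $\psi\colon X\rightharpoonup 1$ (equivalently, maps $X^{\mathrm{op}}\to\mathsf V$) with the structure of the exponential $\mathsf V^{X^{\mathrm{op}}}$, i.e. the unique one such that for each space $Z$ a function $h\colon Z\to PX$ is a map iff $(z,\mathfrak x)\mapsto h(z)(\mathfrak x)$ is a map $Z\otimes X^{\mathrm{op}}\to\mathsf V$ (this structure exists). The Yoneda embedding is $y_X\colon X\to PX$, $x\mapsto x^*$. $X$ is cocomplete if $y_X$ has a left adjoint $\mathrm{Sup}_X\colon PX\to X$ in $\mathsf{Top}$/$\mathsf{App}$; a cocomplete $X$ is completely distributive if $\mathrm{Sup}_X$ has a left adjoint $t_X\colon X\to PX$ in $\mathsf{Top}$/$\mathsf{App}$. $\mathsf{CDTop}$ (respectively $\mathsf{CDApp}$) is the category of completely distributive T$_0$ topological (respectively approach) spaces and those maps which have both a left adjoint and a right adjoint in $\mathsf{Top}$ (respectively $\mathsf{App}$). $D$: $DX=PX$, and for $f\colon X\to Y$, $Df\colon PY\to PX$, $\psi\mapsto\psi\circ f_*$. $S$: $SL=A$, where $i\colon A\to L$ is the equaliser (in $\mathsf{Top}$/$\mathsf{App}$) of $t_L,y_L\colon L\to PL$; for $f\colon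 L\to M$ with left adjoint $g\colon M\to L$, $Sf\colon SM\to SL$ is the restriction of $g$. $\eta_X\colon X\to SDX$ is the corestriction of $y_X$, $x\mapsto x^*$. $\varepsilon_L\colon L\to DSL=PA$ is $x\mapsto x^*\circ i_*$. *)

(* Defs.v *)
From HB Require Import structures.
From mathcomp Require Import all_boot all_order all_algebra.
From mathcomp Require Import boolp classical_sets functions filter.
From mathcomp Require Import reals constructive_ereal ereal.
Set Implicit Arguments.
Unset Strict Implicit.
Unset Printing Implicit Defensive.
Import Order.TTheory GRing.Theory Num.Theory.
Local Open Scope classical_set_scope.

Record ultra (X : Type) := Ultra {
  uset :> set X -> Prop;
  uset_ultra : UltraFilter uset }.

#[global] Existing Instance uset_ultra.

Lemma ultra_eq X (u v : ultra X) : (forall A, u A <-> v A) -> u = v.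
Proof.
case: u v => [F UF] [G UG] /= FG.
have {}FG : F = G by apply/funext => A; apply/propext/FG.
by case: _ / FG in UG *; congr Ultra; apply: Prop_irrelevance.
Qed.

Lemma ultra_of_dec X (F : set_system X) : ProperFilter F ->
  (forall A, F A \/ F (~` A)) -> UltraFilter F.
Proof.
move=> PF FC; split=> // G PG FG; apply/seteqP; split=> // A GA.
have [//|/FG GCA] := FC A.
have: G (A `&` ~` A) by apply: filterI.
rewrite setICr => G0.
by case: (@filter_not_empty _ G PG G0).
Qed.

Lemma fmap_ultra X Y (f : X -> Y) (u : ultra X) :
  UltraFilter [set A | u (f @^-1` A)].
Proof.
have PF : ProperFilter [set A | u (f @^-1` A)].
  exact: (@fmap_proper_filter _ _ f _ _).
apply: (ultra_of_dec PF) => A.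
by rewrite /mkset preimage_setC; apply: in_ultra_setVsetC.
Qed.

Definition umap X Y (f : X -> Y) (u : ultra X) : ultra Y :=
  Ultra (fmap_ultra f u).

Definition upt X (x : X) : ultra X := Ultra (principal_filter_ultra x).

Definition usharp X (A : set X) : set (ultra X) := [set u | u A].

Lemma umult_ultra X (UU : ultra (ultra X)) :
  UltraFilter [set A | UU (usharp A)].
Proof.
have PF : ProperFilter [set A | UU (usharp A)].
  have U0 : ~ UU set0 by exact: filter_not_empty.
  split=> [h|].
    apply: U0; apply: (@filterS _ (uset UU)) h => u.
    exact: (@filter_not_empty _ (uset u)).
  constructor=> [|A B UA UB|A B AB UA].
  - by apply: (@filterS _ (uset UU) _ setT) filterT => u _; apply: filterT.
  - have : UU (usharp A `&` usharp B) by apply: filterI.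
    by apply: filterS => u [uA uB]; apply: (@filterI _ (uset u)).
  - by apply: (@filterS _ (uset UU)) UA => u; apply: (@filterS _ (uset u)).
apply: (ultra_of_dec PF) => A.
have [UA|UA] := in_ultra_setVsetC (usharp A) (uset_ultra UU); [by left|right].
apply: (@filterS _ (uset UU)) UA => u uA; have [//|] := in_ultra_setVsetC A (uset_ultra u).
exact.
Qed.

Definition umult X (UU : ultra (ultra X)) : ultra X := Ultra (umult_ultra UU).

Lemma uptE X (x : X) (A : set X) : upt x A = A x.
Proof. by apply/propext; apply: principal_filterP. Qed.

(* Commutative integral quantales; [qsup]/[qinf] are the joins/meets of [qle] *)

Record quantale := Quantale {
  qcar :> Type;
  qle : qcar -> qcar -> Prop;
  qsup : set qcar -> qcar;
  qinf : set qcar -> qcar;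
  qten : qcar -> qcar -> qcar;
  qunit : qcar;
  qle_refl : forall u, qle u u;
  qle_trans : forall v u w, qle u v -> qle v w -> qle u w;
  qle_anti : forall u v, qle u v -> qle v u -> u = v;
  qsup_ub : forall (S : set qcar) v, S v -> qle v (qsup S);
  qsup_le : forall (S : set qcar) w,
    (forall v, S v -> qle v w) -> qle (qsup S) w;
  qinf_lb : forall (S : set qcar) v, S v -> qle (qinf S) v;
  qinf_ge : forall (S : set qcar) w,
    (forall v, S v -> qle w v) -> qle w (qinf S);
  qtenC : forall u v, qten u v = qten v u;
  qtenA : forall u v w, qten u (qten v w) = qten (qten u v) w;
  qten1 : forall u, qten u qunit = u;
  qten_sup : forall u (S : set qcar),
    qten u (qsup S) = qsup [set qten u v | v in S];
  qunit_top : forall u, qle u qunit }.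

Arguments qunit {_}.

Declare Scope quantale_scope.
Delimit Scope quantale_scope with Q.
Local Open Scope quantale_scope.
Notation "u ⊑ v" := (qle u v) (at level 70) : quantale_scope.
Notation "u ⊗ v" := (qten u v) (at level 40, left associativity)
  : quantale_scope.

Definition qbot (V : quantale) : V := qsup set0.

Record value_space := ValueSpace {
  vq :> quantale;
  vlim : ultra vq -> vq -> vq }.

Arguments vlim : clear implicits.

Definition bool_quantale : quantale.
Proof.
apply: (@Quantale bool (fun u v => u ==> v)
  (fun S => `[< S true >]) (fun S => `[< ~ S false >]) andb true).
- by case.
- by do 3!case.
- by do 2!case.
- by move=> S [] // St; apply/asboolP.
- by move=> S [] h; rewrite ?implybT // implybF; apply/asboolP => /h.
- by move=> S [] //; rewrite ?implybT // implybF => Sf; apply/asboolP; apply.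
- by move=> S [] // h; apply/asboolP => /h.
- exact: andbC.
- exact: andbA.
- exact: andbT.
- move=> [] S /=.
    by apply/asboolP/asboolP; [exists true|case=> [[]]].
  by apply/esym/asboolPn => -[].
- by case.
Defined.

(* Sierpinski space, with {true} closed (and not open) *)
Definition sierpinski_open (O : set bool) : Prop :=
  O = set0 \/ O = [set false] \/ O = setT.

Definition sierpinski_lim (u : ultra bool) (x : bool) : bool :=
  `[< forall O, sierpinski_open O -> O x -> u O >].

Definition topological : value_space :=
  @ValueSpace bool_quantale sierpinski_lim.

Section Approach.
Variable R : realType.
Local Open Scope ereal_scope.

Definition nnereal : Type := {x : \bar R | 0 <= x}.

Lemma nn_inf_ge0 (S : set nnereal) : 0 <= ereal_inf [set sval v | v in S].
Proof. by apply: le_ereal_inf_tmp => _ [v _ <-]; apply: (svalP v). Qed.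

Definition nnmk (x : \bar R) (x0 : 0 <= x) : nnereal :=
  exist (fun y : \bar R => 0 <= y) x x0.

Definition nn_inf (S : set nnereal) : nnereal := nnmk (nn_inf_ge0 S).

(* the maximum with 0 only matters for the empty set, whose supremum is -oo in
   \bar R but 0 in [0, +oo] *)
Lemma nn_sup_ge0 (S : set nnereal) :
  0 <= maxe 0 (ereal_sup [set sval v | v in S]).
Proof. by rewrite le_max lexx. Qed.

Definition nn_sup (S : set nnereal) : nnereal := nnmk (nn_sup_ge0 S).

Definition nn_add (u v : nnereal) : nnereal :=
  nnmk (adde_ge0 (svalP u) (svalP v)).

Definition nn_zero : nnereal := nnmk (lexx 0).

Lemma nn_inj (u v : nnereal) : sval u = sval v -> u = v.
Proof. exact: val_inj. Qed.

Lemma nn_addE (u : nnereal) (S : set nnereal) :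
  nn_add u (nn_inf S) = nn_inf [set nn_add u v | v in S].
Proof.
apply/nn_inj/eqP => /=; rewrite eq_le; apply/andP; split.
  apply: le_ereal_inf_tmp => _ [_ [v Sv <-] <-] /=.
  by apply: leeD2l; apply: ereal_inf_lbound; exists v.
case: u => [[r| |] // r0] /=; last first.
  rewrite addye; first exact: leey.
  by apply/negP => /eqP h; have := nn_inf_ge0 S; rewrite h.
rewrite -leeBlDl //; apply: le_ereal_inf_tmp => _ [v Sv <-].
rewrite leeBlDl //; apply: ereal_inf_lbound => /=.
by exists (nn_add (@nnmk r%:E r0) v) => //; exists v.
Qed.

(* the order is the reverse of the numerical one, so that joins are numerical
   infima *)
Definition nn_quantale : quantale.
Proof.
apply: (@Quantale nnereal (fun u v => sval v <= sval u)
  nn_inf nn_sup nn_add nn_zero).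
- by move=> u.
- by move=> v u w vu wv; apply: le_trans wv vu.
- by move=> u v vu uv; apply/nn_inj/eqP; rewrite eq_le uv vu.
- by move=> S v Sv; apply: ereal_inf_lbound; exists v.
- by move=> S w h; apply: le_ereal_inf_tmp => _ [v /h ? <-].
- move=> S v Sv; rewrite le_max; apply/orP; right.
  by apply: ereal_sup_ubound; exists v.
- move=> S w h; rewrite ge_max (svalP w) /=.
  by apply: ge_ereal_sup => _ [v /h ? <-].
- by move=> u v; apply/nn_inj/addeC.
- by move=> u v w; apply/nn_inj/addeA.
- by move=> u; apply/nn_inj/adde0.
- exact: nn_addE.
- by move=> u; apply: (svalP u).
Defined.

Definition nn_xi (u : ultra nnereal) : \bar R :=
  ereal_sup [set ereal_inf [set sval v | v in A] | A in uset u].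

(* in \bar R, +oo - +oo = -oo, so that the maximum below is then 0 *)
Lemma nn_lim_ge0 (u : ultra nnereal) (x : nnereal) :
  0 <= maxe (sval x - nn_xi u) 0.
Proof. by rewrite le_max lexx orbT. Qed.

Definition nn_lim (u : ultra nnereal) (x : nnereal) : nnereal :=
  nnmk (nn_lim_ge0 u x).

Definition approach : value_space := @ValueSpace nn_quantale nn_lim.

End Approach.

Section Relations.
Variable V : quantale.

Definition vrel (X Y : Type) := X -> Y -> V.

Definition vrel_le X Y (r s : vrel X Y) : Prop := forall x y, r x y ⊑ s x y.

Definition vcomp X Y Z (s : vrel Y Z) (r : vrel X Y) : vrel X Z :=
  fun x z => qsup [set r x y ⊗ s y z | y in setT].

Definition vconv X Y (r : vrel X Y) : vrel Y X := fun y x => r x y.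

Definition vgraph X Y (f : X -> Y) : vrel X Y :=
  fun x y => if `[< f x = y >] then qunit else qbot V.

Definition uext X Y (r : vrel X Y) : vrel (ultra X) (ultra Y) := fun u v =>
  qinf [set qsup [set r x y | x in A & y in B]
         | A in uset u & B in uset v].

Definition urel (X Y : Type) := vrel (ultra X) Y.

(* the Kleisli composite of U-relations, s . Ur . m_X^o *)
Definition kcomp X Y Z (s : urel Y Z) (r : urel X Y) : urel X Z :=
  vcomp (vcomp s (uext r)) (vconv (vgraph (@umult X))).

Definition is_space X (a : urel X X) : Prop :=
  vrel_le (vconv (vgraph (@upt X))) a /\
  vrel_le (vcomp (vcomp a (uext a)) (vconv (vgraph (@umult X)))) a.

Record space := Space {
  pts :> Type;
  lim : urel pts pts;
  lim_space : is_space lim }.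

Definition is_map X Y (a : urel X X) (b : urel Y Y) (f : X -> Y) : Prop :=
  forall u x, a u x ⊑ b (umap f u) (f x).

Record smap (X Y : space) := SMap {
  sfun :> X -> Y;
  sfun_map : is_map (@lim X) (@lim Y) sfun }.

Definition map_le (X Y : space) (f g : X -> Y) : Prop :=
  forall x, qunit ⊑ lim (upt (f x)) (g x).

(* [adj f g]: f is left adjoint to g *)
Definition adj (X Y : space) (f : X -> Y) (g : Y -> X) : Prop :=
  @map_le X X id (g \o f) /\ @map_le Y Y (f \o g) id.

Definition T0 (X : space) : Prop :=
  forall x y : X, qunit ⊑ lim (upt x) y -> qunit ⊑ lim (upt y) x -> x = y.

End Relations.

Arguments vgraph {V X Y} f.
Arguments lim {V} s _ _.
Arguments lim_space {V} s.

Section Lemmas.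
Variable V : quantale.

Lemma qten_le (u u' v v' : V) : u ⊑ u' -> v ⊑ v' -> u ⊗ v ⊑ u' ⊗ v'.
Proof.
have mono (x y z : V) : y ⊑ z -> x ⊗ y ⊑ x ⊗ z.
  move=> yz; have -> : z = qsup [set y; z].
    apply: qle_anti; first by apply: qsup_ub; right.
    by apply: qsup_le => _ [->|->] //; apply: qle_refl.
  by rewrite qten_sup; apply: qsup_ub; exists y => //; left.
move=> uu vv; apply: qle_trans (mono _ _ _ vv) _.
by rewrite qtenC [_ ⊗ v']qtenC; apply: mono.
Qed.

Lemma qten1l (u : V) : qunit ⊗ u = u. Proof. by rewrite qtenC qten1. Qed.

Lemma qten0l (u : V) : qbot V ⊗ u = qbot V.
Proof.
by rewrite qtenC qten_sup image_set0.
Qed.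

Lemma qbot_le (u : V) : qbot V ⊑ u. Proof. exact: qsup_le. Qed.

Lemma uext_upt X Y (r : vrel V X Y) x y : r x y ⊑ uext r (upt x) (upt y).
Proof.
apply: qinf_ge => _ [A Ax [B By <-]]; apply: qsup_ub.
by exists x; [apply: Ax|exists y; first exact: By].
Qed.

Lemma kcomp_leP X Y Z (s : urel V Y Z) (r : urel V X Y) (t : urel V X Z) :
  vrel_le (kcomp s r) t <->
  forall UU (u : ultra Y) z, uext r UU u ⊗ s u z ⊑ t (umult UU) z.
Proof.
split=> [h UU u z|h p z].
  apply: qle_trans (h _ _); apply: qle_trans; last first.
    by apply: qsup_ub; exists UU.
  rewrite /vconv /vgraph asboolT // qten1l.
  by apply: qsup_ub; exists u.
apply: qsup_le => _ [UU _ <-]; rewrite /vconv /vgraph.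
case: asboolP => [<-|_]; last by rewrite qten0l; apply: qbot_le.
by rewrite qten1l; apply: qsup_le => _ [u _ <-].
Qed.

Lemma is_spaceP X (a : urel V X X) : is_space a <->
  (forall x, qunit ⊑ a (upt x) x) /\
  (forall UU u x, uext a UU u ⊗ a u x ⊑ a (umult UU) x).
Proof.
split=> [[h1 h2]|[h1 h2]]; split.
- by move=> x; move: (h1 (upt x) x); rewrite /vconv /vgraph asboolT.
- by apply/kcomp_leP; apply: h2.
- move=> u x; rewrite /vconv /vgraph.
  by case: asboolP => [<-|_]; [apply: h1|apply: qbot_le].
- by apply/(@kcomp_leP _ _ _ a a a); apply: h2.
Qed.

Lemma lim_refl (X : space V) (x : X) : qunit ⊑ lim X (upt x) x.
Proof. by have [h _] := (is_spaceP (lim X)).1 (lim_space X); apply: h. Qed.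

Lemma lim_mult (X : space V) UU u (x : X) :
  uext (lim X) UU u ⊗ lim X u x ⊑ lim X (umult UU) x.
Proof. by have [_ h] := (is_spaceP (lim X)).1 (lim_space X); apply: h. Qed.

Lemma umap_upt X Y (f : X -> Y) x : umap f (upt x) = upt (f x).
Proof.
apply: ultra_eq => A; rewrite uptE.
by rewrite [umap _ _ _](_ : _ = upt x (f @^-1` A)) // uptE.
Qed.

Lemma umap_id X (u : ultra X) : umap id u = u.
Proof. by apply: ultra_eq => A; split. Qed.

Lemma umap_comp X Y Z (g : Y -> Z) (f : X -> Y) u :
  umap (g \o f) u = umap g (umap f u).
Proof. by apply: ultra_eq => A; split. Qed.

Lemma umult_upt X (u : ultra X) : umult (upt u) = u.
Proof.
apply: ultra_eq => A.
by rewrite [umult _ _](_ : _ = upt u (usharp A)) // uptE.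
Qed.

Lemma umult_umap_upt X (u : ultra X) : umult (umap (@upt X) u) = u.
Proof.
apply: ultra_eq => A.
rewrite [umult _ _](_ : _ = u (fun x => upt x A)) //.
by under [fun x => _]funext do rewrite uptE.
Qed.

Lemma umult_umap X Y (f : X -> Y) UU :
  umult (umap (umap f) UU) = umap f (umult UU).
Proof. by apply: ultra_eq => A; split. Qed.

Lemma uext_umap X Y X' Y' (f : X -> X') (g : Y -> Y')
    (r : vrel V X Y) (r' : vrel V X' Y') :
  (forall x y, r x y ⊑ r' (f x) (g y)) ->
  forall u v, uext r u v ⊑ uext r' (umap f u) (umap g v).
Proof.
move=> rr' u v; apply: qinf_ge => _ [A uA [B vB <-]].
apply: qle_trans; first by apply: qinf_lb; exists (f @^-1` A) => //;
  exists (g @^-1` B).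
apply: qsup_le => _ [x Ax [y By <-]].
apply: qle_trans (rr' _ _) _.
by apply: qsup_ub; exists (f x) => //; exists (g y).
Qed.

Lemma lim_trans (X : space V) (x y z : X) :
  lim X (upt x) y ⊗ lim X (upt y) z ⊑ lim X (upt x) z.
Proof.
have := @lim_mult X (upt (upt x)) (upt y) z; rewrite umult_upt.
by apply: qle_trans; apply: qten_le; [apply: uext_upt|apply: qle_refl].
Qed.

Lemma map_le_trans (X Y : space V) (g f h : X -> Y) :
  map_le f g -> map_le g h -> map_le f h.
Proof.
move=> fg gh x; apply: qle_trans (lim_trans (f x) (g x) (h x)).
by rewrite -(qten1 qunit); apply: qten_le; [apply: fg|apply: gh].
Qed.

Lemma map_le_whisker (X Y Z W : space V) (l : smap Z W) (f g : Y -> Z)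
    (h : X -> Y) : map_le f g -> map_le (l \o f \o h) (l \o g \o h).
Proof.
move=> fg x; apply: qle_trans (fg (h x)) _ => /=.
by apply: qle_trans (sfun_map l _ _) _; rewrite umap_upt; apply: qle_refl.
Qed.

Lemma adj_id (X : space V) : adj (@id X) (@id X).
Proof. by split=> x; apply: lim_refl. Qed.

Lemma adj_comp (X Y Z : space V) (f : smap X Y) (g : smap Y X)
    (f' : smap Y Z) (g' : smap Z Y) :
  adj f g -> adj f' g' -> adj (f' \o f) (g \o g').
Proof.
move=> [u1 c1] [u2 c2]; split.
  exact: map_le_trans u1 (map_le_whisker g f u2).
exact: map_le_trans (map_le_whisker f' g' c1) c2.
Qed.

Lemma smap_eq (X Y : space V) (f g : smap X Y) : sfun f = sfun g -> f = g.
Proof.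
case: f g => [f Hf] [g Hg] /= fg; subst g.
by congr SMap; apply: Prop_irrelevance.
Qed.

Lemma is_map_id (X : space V) : is_map (lim X) (lim X) id.
Proof. by move=> u x; rewrite umap_id; apply: qle_refl. Qed.

Definition smap_id (X : space V) : smap X X := SMap (@is_map_id X).

Lemma is_map_comp (X Y Z : space V) (g : smap Y Z) (f : smap X Y) :
  is_map (lim X) (lim Z) (g \o f).
Proof.
move=> u x; rewrite umap_comp.
exact: qle_trans (sfun_map f _ _) (sfun_map g _ _).
Qed.

Definition smap_comp (X Y Z : space V) (g : smap Y Z) (f : smap X Y) :
  smap X Z := SMap (@is_map_comp X Y Z g f).

Lemma indiscrete_is_space (X : Type) :
  is_space (fun (_ : ultra X) (_ : X) => @qunit V).
Proof.
by apply/is_spaceP; split=> *; [apply: qle_refl|apply: qunit_top].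
Qed.

Definition indiscrete (X : Type) : space V := Space (indiscrete_is_space X).

(* the structure of a one-point space is unique, since 1 is reflexive and
   the unit is the top element *)
Definition one : space V := indiscrete unit.

Lemma sub_is_space (X : space V) (A : set X) :
  is_space (fun (u : ultra {x | A x}) x => lim X (umap sval u) (sval x)).
Proof.
apply/is_spaceP; split=> [x|UU u x].
  by rewrite umap_upt; apply: lim_refl.
rewrite -umult_umap; apply: qle_trans (lim_mult _ (umap sval u) _).
apply: qten_le; last exact: qle_refl.
by apply: uext_umap => v y; apply: qle_refl.
Qed.

Definition subspace (X : space V) (A : set X) : space V :=
  Space (sub_is_space A).

Definition equaliser (X Y : space V) (f g : X -> Y) : space V :=
  subspace [set x | f x = g x].

Lemma equaliser_incl_map (X Y : space V) (f g : X -> Y) :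
  is_map (lim (equaliser f g)) (lim X) sval.
Proof. by move=> u x; apply: qle_refl. Qed.

Definition equaliser_incl (X Y : space V) (f g : X -> Y) :
  smap (equaliser f g) X := SMap (@equaliser_incl_map X Y f g).

Lemma equaliserP (X Y Z : space V) (f g : X -> Y) (h : smap Z X) :
  f \o h = g \o h ->
  exists! k : smap Z (equaliser f g), sfun h = equaliser_incl f g \o k.
Proof.
move=> fgh; have E z : f (h z) = g (h z) by apply: (congr1 (@^~ z) fgh).
pose k z : equaliser f g := exist _ (h z) (E z).
have km : is_map (lim Z) (lim (equaliser f g)) k.
  move=> u z; apply: qle_trans (sfun_map h u z) _ => /=.
  by rewrite -umap_comp; apply: qle_refl.
exists (SMap km); split=> // k' hk'; apply: smap_eq; apply/funext => z.
have : h z = sval (k' z) by rewrite hk'.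
by rewrite /= /k; move: (E z); case: (k' z) => y Ey Ez /= hz; apply: eq_exist.
Qed.

(* the convergence structure of X^op, on the set of ultrafilters of X *)
Definition op_lim (X : space V) : urel V (ultra X) (ultra X) :=
  fun UU u => vcomp (uext (lim X)) (vconv (vgraph (@umult X))) u (umult UU).

Definition tensor_lim X Y (a : urel V X X) (b : urel V Y Y) :
    urel V (X * Y) (X * Y) :=
  fun w p => a (umap fst w) p.1 ⊗ b (umap snd w) p.2.

Definition is_umodule (X Y : space V) (phi : urel V X Y) : Prop :=
  kcomp phi (lim X) = phi /\ kcomp (lim Y) phi = phi.

Record umodule (X Y : space V) := UModule {
  umod :> ultra X -> Y -> V;
  umodP : is_umodule umod }.

(* f_* and x^* *)
Definition lower_star (X Y : space V) (f : X -> Y) : urel V X Y :=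
  fun u y => lim Y (umap f u) y.

Definition point_star (X : space V) (x : X) : urel V X one :=
  fun u _ => lim X u x.

Lemma vrel_anti X Y (r s : vrel V X Y) : vrel_le r s -> vrel_le s r -> r = s.
Proof.
move=> rs sr; apply/funext => x; apply/funext => y.
exact: qle_anti (rs x y) (sr x y).
Qed.

Lemma kcomp_id_le (X : space V) Y (phi : urel V X Y) :
  vrel_le phi (kcomp phi (lim X)).
Proof.
move=> u y; have /kcomp_leP h : vrel_le (kcomp phi (lim X))
  (kcomp phi (lim X)) by move=> ? ?; apply: qle_refl.
have := h (umap (@upt X) u) u y.
rewrite umult_umap_upt; apply: qle_trans; rewrite -{1}(qten1l (phi u y)).
apply: qten_le; last exact: qle_refl.
apply: qinf_ge => _ [A uA [B uB <-]].
have [x [Ax Bx]] := filter_ex (filterI (F := uset u) uA uB).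
apply: qle_trans (lim_refl x) _; apply: qsup_ub.
by exists (upt x) => //; exists x.
Qed.

Lemma point_star_umodule (X : space V) (x : X) : is_umodule (point_star x).
Proof.
split; apply: vrel_anti.
- apply/(@kcomp_leP X X one) => UU u [] /=; exact: lim_mult.
- exact: kcomp_id_le.
- apply/(@kcomp_leP X one one) => UU w [].
  rewrite qten1 /point_star; apply: qle_trans (lim_mult UU (upt x) x).
  apply: (@qle_trans _ (uext (lim X) UU (upt x) ⊗ qunit)); last first.
    by apply: qten_le; [apply: qle_refl|apply: lim_refl].
  rewrite qten1; apply: qinf_ge => _ [A UA [B Bx <-]].
  apply: qle_trans; first by apply: qinf_lb; exists A => //; exists setT;
    first exact: filterT.
  apply: qsup_le => _ [v Av [[] _ <-]]; apply: qsup_ub.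
  by exists v => //; exists x => //; rewrite -uptE.
- move=> u []; have /kcomp_leP h : vrel_le (kcomp (lim one) (point_star x))
    (kcomp (lim one) (point_star x)) by move=> ? ?; apply: qle_refl.
  have := h (upt u) (upt tt) tt; rewrite umult_upt; apply: qle_trans.
  by rewrite qten1; apply: uext_upt (point_star x) u tt.
Qed.

Lemma umodule_eq (X Y : space V) (phi psi : umodule X Y) :
  umod phi = umod psi -> phi = psi.
Proof.
case: phi psi => [p Hp] [q Hq] /= pq; subst q.
by congr UModule; apply: Prop_irrelevance.
Qed.

End Lemmas.

Arguments one {V}.
Arguments op_lim {V} X _ _.

Section Presheaf.
Variable V : value_space.

(* [c] is a structure on PX making it the exponential V^(X^op) *)
Definition is_exponential_lim (X : space V)
    (c : urel V (umodule X one) (umodule X one)) : Prop :=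
  is_space c /\
  forall (Z : space V) (h : Z -> umodule X one),
    is_map (lim Z) c h <->
    is_map (tensor_lim (lim Z) (op_lim X)) (vlim V)
      (fun p : Z * ultra X => h p.1 p.2 tt).

Lemma exponential_lim_unique (X : space V) c c' :
  @is_exponential_lim X c -> is_exponential_lim c' -> c = c'.
Proof.
suff le (d d' : urel V (umodule X one) (umodule X one)) :
    is_exponential_lim d -> is_exponential_lim d' -> vrel_le d d'.
  by move=> hc hc'; apply: vrel_anti; [apply: le hc hc'|apply: le hc' hc].
move=> [sd hd] [_ hd'] u x; rewrite -{2}(umap_id u).
apply: (hd' (Space sd) id).2; apply/(hd (Space sd) id).
exact: (@is_map_id V (Space sd)).
Qed.

(* the exponential structure (unique if it exists), totalised by the
   indiscrete one *)
Definition presheaf_lim (X : space V) :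
    {c : urel V (umodule X one) (umodule X one) | is_space c} :=
  match pselect (exists c, @is_exponential_lim X c) with
  | left h => exist _ (sval (cid h)) (svalP (cid h)).1
  | right _ => exist _ _ (indiscrete_is_space V (umodule X one))
  end.

Definition presheaf (X : space V) : space V :=
  @Space V (umodule X one) (sval (presheaf_lim X)) (svalP (presheaf_lim X)).

Definition yoneda (X : space V) (x : X) : presheaf X :=
  UModule (point_star_umodule x).

Definition cocomplete (X : space V) : Prop :=
  exists Sup : smap (presheaf X) X, adj Sup (@yoneda X).

Definition completely_distributive (X : space V) : Prop :=
  cocomplete X /\
  exists (t : smap X (presheaf X)) (Sup : smap (presheaf X) X),
    adj Sup (@yoneda X) /\ adj t Sup.

Record cdspace := CDSpace {
  cdsp :> space V;
  cdsp_T0 : T0 cdsp;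
  cdsp_cd : completely_distributive cdsp }.

(* t_L; since L and PL are T0, it does not depend on choices *)
Definition cd_t (L : cdspace) : smap L (presheaf L) :=
  sval (cid (cdsp_cd L).2).

Record cdmap (L M : cdspace) := CDMap {
  cdfun :> smap L M;
  cdfun_left : exists g : smap M L, adj g cdfun;
  cdfun_right : exists g : smap M L, adj cdfun g }.

Lemma cdmap_eq (L M : cdspace) (f g : cdmap L M) :
  (f : L -> M) = g -> f = g.
Proof.
case: f g => [f fl fr] [g gl gr] /= fg.
have {}fg : f = g := smap_eq fg.
by subst g; congr CDMap; apply: Prop_irrelevance.
Qed.

Definition cdmap_id (L : cdspace) : cdmap L L.
Proof.
by apply: (@CDMap L L (smap_id L)); exists (smap_id L); apply: adj_id.
Defined.

Definition cdmap_comp (L M N : cdspace) (g : cdmap M N) (f : cdmap L M) :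
  cdmap L N.
Proof.
apply: (@CDMap L N (smap_comp g f)).
- have [f' ff'] := cdfun_left f; have [g' gg'] := cdfun_left g.
  by exists (smap_comp f' g'); apply: adj_comp.
- have [f' ff'] := cdfun_right f; have [g' gg'] := cdfun_right g.
  by exists (smap_comp f' g'); apply: adj_comp.
Defined.

End Presheaf.

Arguments yoneda {V} X x.

Record category := Category {
  obj :> Type;
  hom : obj -> obj -> Type;
  idm : forall A, hom A A;
  cmp : forall A B C, hom B C -> hom A B -> hom A C;
  cmp1m : forall A B (f : hom A B), cmp (idm B) f = f;
  cmpm1 : forall A B (f : hom A B), cmp f (idm A) = f;
  cmpA : forall A B C D (h : hom C D) (g : hom B C) (f : hom A B),
    cmp h (cmp g f) = cmp (cmp h g) f }.

Arguments idm {_} A.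

Definition op (C : category) : category :=
  @Category C (fun A B => hom B A) (fun A => idm A)
    (fun A B D g f => cmp f g)
    (fun A B f => cmpm1 f) (fun A B f => cmp1m f)
    (fun A B C D h g f => esym (cmpA f g h)).

(* functors with a given action on objects *)
Record functor_on (C D : category) (F : C -> D) := FunctorOn {
  fmor : forall A B : C, hom A B -> hom (F A) (F B);
  fmor_id : forall A, fmor (idm A) = idm (F A);
  fmor_cmp : forall (A B E : C) (g : hom B E) (f : hom A B),
    fmor (cmp g f) = cmp (fmor g) (fmor f) }.

Definition functor_id (C : category) : functor_on (fun A : C => A) :=
  @FunctorOn C C _ (fun A B f => f) (fun A => erefl) (fun A B E g f => erefl).

Definition functor_comp (C D E : category) (F : C -> D) (G : D -> E)
    (GG : functor_on G) (FF : functor_on F) : functor_on (fun A => G (F A)).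
Proof.
apply: (@FunctorOn C E _ (fun A B f => fmor GG (fmor FF f))).
- by move=> A; rewrite !fmor_id.
- by move=> A B K g f; rewrite !fmor_cmp.
Defined.

Record nat_trans (C D : category) (F G : C -> D)
    (FF : functor_on F) (GG : functor_on G) := NatTrans {
  ntr :> forall A, hom (F A) (G A);
  ntr_nat : forall (A B : C) (f : hom A B),
    cmp (ntr B) (fmor FF f) = cmp (fmor GG f) (ntr A) }.

(* Top and App, for V = topological and V = approach R *)
Definition Sp (V : quantale) : category.
Proof.
apply: (@Category (space V) (@smap V) (@smap_id V) (@smap_comp V)).
- by move=> X Y f; apply: smap_eq.
- by move=> X Y f; apply: smap_eq.
- by move=> X Y Z W h g f; apply: smap_eq.
Defined.

(* CDTop and CDApp *)
Definition CDSp (V : value_space) : category.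
Proof.
apply: (@Category (cdspace V) (@cdmap V) (@cdmap_id V) (@cdmap_comp V)).
- by move=> X Y f; apply: cdmap_eq.
- by move=> X Y f; apply: cdmap_eq.
- by move=> X Y Z W h g f; apply: cdmap_eq.
Defined.

Section Duality.
Variable V : value_space.

Definition Dobj
    (HD : forall X : space V,
      T0 (presheaf X) /\ completely_distributive (presheaf X)) :
    op (Sp V) -> CDSp V :=
  fun X => CDSpace (HD X).1 (HD X).2.

Definition Sobj : CDSp V -> op (Sp V) :=
  fun L => equaliser (cd_t L) (yoneda L).

Definition Sincl (L : cdspace V) : smap (Sobj L) L :=
  equaliser_incl (cd_t L) (yoneda L).

End Duality.

Arguments Sincl {V} L.

(* Main.v *)
(** A U-relation r from X to Y acts through its extension [hat r], a V-relation
    between the sets of ultrafilters: [kcomp s r] is the ordinary composite of s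
    with [hat r].  The operation [hat] is laxly functorial because the ultrafilter
    multiplication has the Beck-Chevalley property, and oplaxly functorial because
    the tensor of V preserves limits along ultrafilters.  In the exponential PX,
    the degree to which psi is a limit of p is the meet over u of the residuals
    hom (hat ev u p, psi u), where ev is evaluation; in this form the Yoneda lemma
    says that psi is a limit of the image of u under y to the degree psi u.

    For a map f, composition with the lower star of f sends psi to psi (U f _).
    It has a left adjoint Pf, composition with the upper star of f, and a right
    adjoint, the residual of the lower star.  For f = y_X these three maps are t,
    Sup and y on PX, so PX is completely distributive.  A map f between completely
    distributive spaces with adjoints g -| f -| h commutes with Sup; passing to left
    adjoints gives t g = Pg t, so g preserves the spectrum.  Finally, t and y agree
    on the spectrum A of L, hence, t being a map, t x and y x agree on ultrafilters
    of A.  So epsilon factors both through y, which has a left adjoint, and through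
    t, which has a right adjoint. *)
From mathcomp Require Import all_boot all_order all_algebra.
From mathcomp Require Import boolp classical_sets filter.
From mathcomp Require Import reals constructive_ereal ereal.
Require Import Defs.
Set Implicit Arguments.
Unset Strict Implicit.
Unset Printing Implicit Defensive.
Import Order.TTheory GRing.Theory Num.Theory.
Local Open Scope classical_set_scope.
Local Open Scope quantale_scope.

(** * Ultrafilters, relations between them, and the multiplication *)

Section Ultrafilters.
Implicit Types X Y : Type.

Lemma ultra_extend I X (D : set I) (B : I -> set X) :
  (exists i, D i) ->
  (forall i j, D i -> D j -> exists2 k, D k & B k `<=` B i `&` B j) ->
  (forall i, D i -> B i !=set0) ->
  exists u : ultra X, forall i, D i -> u (B i).
Proof.
move=> D0 DI B0.
have [F [UF DF]] := ultraFilterLemma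
  (filter_from_proper (filter_from_filter D0 DI) B0).
by exists (Ultra UF) => i Di; apply: DF; exists i.
Qed.

Lemma ultraS X (u : ultra X) A B : A `<=` B -> u A -> u B.
Proof. exact: (@filterS _ (uset u)). Qed.

Lemma ultraT X (u : ultra X) : u setT.
Proof. exact: filterT. Qed.

Lemma ultra_setI X (u : ultra X) A B : u A -> u B -> u (A `&` B).
Proof. exact: filterI. Qed.

Lemma ultra_sub_eq X (u v : ultra X) : (forall A, u A -> v A) -> u = v.
Proof.
move=> uv; apply: ultra_eq => A; split; first exact: uv.
have [//|uCA vA] := in_ultra_setVsetC A (uset_ultra u).
have : v (A `&` ~` A) by apply: ultra_setI => //; apply: uv.
by rewrite setICr => /(@filter_not_empty _ (uset v)).
Qed.

Lemma ultra_meet X (u : ultra X) B :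
  (forall A, u A -> A `&` B !=set0) -> u B.
Proof.
move=> uB; have [//|/uB] := in_ultra_setVsetC B (uset_ultra u).
by rewrite setICl => -[].
Qed.

Lemma ultraI X (u : ultra X) A B : u A -> u B -> A `&` B !=set0.
Proof.
by move=> uA uB; have [x ABx] := filter_ex (ultra_setI uA uB); exists x.
Qed.

(** The Barr extension of [r] to ultrafilters, in its form without couplings. *)
Definition urelate X Y (r : X -> Y -> Prop) (u : ultra X) (v : ultra Y) :=
  forall A B, u A -> v B -> exists x y, [/\ A x, B y & r x y].

Lemma urelate_image X Y (r : X -> Y -> Prop) u v A : urelate r u v -> u A ->
  v [set y | exists2 x, A x & r x y].
Proof.
move=> ruv uA; apply: ultra_meet => B /(ruv _ _ uA)[x [y [Ax By rxy]]].
by exists y; split=> //; exists x.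
Qed.

(** The sets of related pairs with components in [A] and [B] form a filter base. An ultrafilter
    extending it projects to [u] and [v], because an ultrafilter contained in another equals it. *)
Lemma urelate_couple X Y (r : X -> Y -> Prop) u v : urelate r u v ->
  exists w : ultra (X * Y),
    [/\ umap fst w = u, umap snd w = v & w [set p | r p.1 p.2]].
Proof.
move=> ruv.
have [|[A B] [A' B'] [uA vB] [uA' vB']|[A B] [uA vB]|w wP] :=
  @ultra_extend (set X * set Y) (X * Y) [set AB | u AB.1 /\ v AB.2]
  (fun AB => [set p | [/\ AB.1 p.1, AB.2 p.2 & r p.1 p.2]]).
- by exists (setT, setT); split; apply: ultraT.
- exists (A `&` A', B `&` B').
    by split; apply: ultra_setI.
  by move=> p [[Ap A'p] [Bp B'p] rp].
- by have [x [y [Ax By rxy]]] := ruv _ _ uA vB; exists (x, y).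
exists w; split.
- apply/esym/ultra_sub_eq => A uA.
  by apply: ultraS (wP (A, setT) (conj uA (ultraT v))) => p [].
- apply/esym/ultra_sub_eq => B vB.
  by apply: ultraS (wP (setT, B) (conj (ultraT u) vB)) => p [].
- by apply: ultraS (wP (setT, setT) (conj (ultraT u) (ultraT v))) => p [].
Qed.

(* The Beck-Chevalley property of the ultrafilter multiplication *)
Lemma urelate_umult X Y (r : X -> Y -> Prop) (u : ultra X)
    (VV : ultra (ultra Y)) : urelate r u (umult VV) ->
  exists UU : ultra (ultra X), umult UU = u /\ urelate (urelate r) UU VV.
Proof.
move=> ruv.
have [|[A B] [A' B'] [uA vB] [uA' vB']|[A B] [uA vB]|UU UUP] :=
  @ultra_extend (set X * set (ultra Y)) (ultra X)
  [set AB | u AB.1 /\ VV AB.2]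
  (fun AB => [set u' : ultra X |
    u' AB.1 /\ exists2 v, AB.2 v & urelate r u' v]).
- by exists (setT, setT); split; apply: ultraT.
- exists (A `&` A', B `&` B').
    by split; apply: ultra_setI.
  move=> u' [] /= u'AA [v [Bv B'v] rv].
  by split; split; try (by exists v); apply: ultraS u'AA => x [].
(* Basic sets are nonempty: [umult VV] contains the image of [A], so some [v] in [B] does too, and
   [u'] extends the sets of points of [A] related to a member of [v]. *)
- have [v [Bv rAv]] := ultraI vB (urelate_image ruv uA : VV (usharp _)).
  have rAv' (C : set Y) : v C -> exists x y, [/\ A x, C y & r x y].
    by move=> /(ultraI rAv)[y [[x Ax rxy] Cy]]; exists x, y.
  have [|C C' vC vC'|C vC|u' u'P] := @ultra_extend (set Y) X [set C | v C]
    (fun C => [set x | A x /\ exists2 y, C y & r x y]).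
  + by exists setT; apply: ultraT.
  + exists (C `&` C'); first exact: ultra_setI.
    by move=> x [Ax [y [Cy C'y] rxy]]; split; split=> //; exists y.
  + by have [x [y [Ax Cy rxy]]] := rAv' _ vC; exists x; split=> //; exists y.
  exists u'; split.
    by apply: ultraS (u'P setT (ultraT v)) => x [].
  exists v => // E C u'E vC.
  by have [x [Ex [Ax [y Cy rxy]]]] := ultraI u'E (u'P _ vC); exists x, y.
exists UU; split.
  apply/esym/ultra_sub_eq => A uA.
  by apply: ultraS (UUP (A, setT) (conj uA (ultraT VV))) => u' [].
move=> A B UUA VVB.
have UUB : UU _ := UUP (setT, B) (conj (ultraT u) VVB).
by have [u' [Au' [_ [v Bv rv]]]] := ultraI UUA UUB; exists u', v.
Qed.

Lemma umult_assoc X (UUU : ultra (ultra (ultra X))) :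
  umult (umap (@umult X) UUU) = umult (umult UUU).
Proof. by apply: ultra_eq => A; split. Qed.

Lemma umap_near X Y (f g : X -> Y) (u : ultra X) : u [set x | f x = g x] ->
  umap f u = umap g u.
Proof.
move=> fg; apply: ultra_sub_eq => A fA.
by apply: ultraS (ultra_setI fg fA) => x []; rewrite /= => <-.
Qed.

End Ultrafilters.


(** * Residuals and limits along ultrafilters in a quantale *)

Section Quantales.
Variable V : quantale.
Implicit Types (u v w : V) (S : set V).

Lemma qsup_ten_le S u w : (forall v, S v -> u ⊗ v ⊑ w) -> u ⊗ qsup S ⊑ w.
Proof.
by move=> h; rewrite qten_sup; apply: qsup_le => _ [v Sv <-]; apply: h.
Qed.

Lemma qten_lel u v w : u ⊑ v -> u ⊗ w ⊑ v ⊗ w.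
Proof. by move=> uv; apply: qten_le => //; apply: qle_refl. Qed.

Lemma qten_ler u v w : u ⊑ v -> w ⊗ u ⊑ w ⊗ v.
Proof. by move=> uv; apply: qten_le => //; apply: qle_refl. Qed.

Lemma qten_unitl u v : qunit ⊑ u -> v ⊑ u ⊗ v.
Proof. by move=> ku; rewrite -{1}(qten1l v); apply: qten_lel. Qed.

(** The meet over [i] of the residuals of [r i] into [s i], written as one join. *)
Definition qres I (r s : I -> V) : V := qsup [set t | forall i, t ⊗ r i ⊑ s i].

Lemma qres_ten I (r s : I -> V) i : qres r s ⊗ r i ⊑ s i.
Proof. by rewrite qtenC; apply: qsup_ten_le => t; rewrite qtenC; apply. Qed.

Lemma qresP I (r s : I -> V) t : t ⊑ qres r s <-> forall i, t ⊗ r i ⊑ s i.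
Proof.
split=> [h i|h]; last exact: qsup_ub.
exact: qle_trans (qten_lel _ h) (qres_ten _ _ _).
Qed.

(* the totally-below relation *)
Definition qbelow v u := forall S, u ⊑ qsup S -> exists2 s, S s & v ⊑ s.

(* the limit of [f] along [w] *)
Definition uxi I (f : I -> V) (w : ultra I) : V :=
  qinf [set qsup [set f i | i in A] | A in uset w].

Lemma uxi_umap I J (g : J -> V) (f : I -> J) (w : ultra I) :
  uxi g (umap f w) = uxi (g \o f) w.
Proof.
apply: qle_anti; apply: qinf_ge => _ [A wA <-].
  apply: qle_trans; first apply: (qinf_lb (v := qsup [set g j | j in f @` A])).
    by exists (f @` A) => //; apply: ultraS wA => i Ai; exists i.
  by apply: qsup_le => _ [_ [i Ai <-] <-]; apply: qsup_ub; exists i.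
apply: qle_trans; first apply: qinf_lb.
  by exists (f @^-1` A).
by apply: qsup_le => _ [i Ai <-]; apply: qsup_ub; exists (f i).
Qed.

Lemma uxi_ge I (f : I -> V) (w : ultra I) v :
  w [set i | v ⊑ f i] -> v ⊑ uxi f w.
Proof.
move=> wv; apply: qinf_ge => _ [A wA <-].
have [i [Ai vi]] := ultraI wA wv; apply: qle_trans vi _.
by apply: qsup_ub; exists i.
Qed.

(** [w] induces a coupling of the two images, and members [A] and [B] of these pull back to one
    member of [w]. *)
Lemma uxi_uext I X Y (r : vrel V X Y) (f : I -> X) (g : I -> Y) (w : ultra I) :
  uxi (fun i => r (f i) (g i)) w ⊑ uext r (umap f w) (umap g w).
Proof.
apply: qinf_ge => _ [A wA [B wB <-]].
apply: qle_trans; first apply: qinf_lb.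
  by exists (f @^-1` A `&` g @^-1` B) => //; apply: ultra_setI.
apply: qsup_le => _ [i [Ai Bi] <-]; apply: qsup_ub.
by exists (f i) => //; exists (g i).
Qed.

Lemma urelate_uext X Y (r : vrel V X Y) (u : ultra X) (v : ultra Y) t :
  urelate (fun x y => t ⊑ r x y) u v -> t ⊑ uext r u v.
Proof.
move=> ruv; apply: qinf_ge => _ [A uA [B vB <-]].
have [x [y [Ax By txy]]] := ruv _ _ uA vB; apply: qle_trans txy _.
by apply: qsup_ub; exists x => //; exists y.
Qed.

(** Total belowness picks one pair out of each join in [uext]. With [urelate_uext], this trades
    inequalities about [uext] for the two-valued [urelate]. *)
Lemma qbelow_uext X Y (r : vrel V X Y) (u : ultra X) (v : ultra Y) t :
  qbelow t (uext r u v) -> urelate (fun x y => t ⊑ r x y) u v.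
Proof.
move=> tuv A B uA vB.
have [|_ [x Ax [y By <-]] txy] := tuv [set r x y | x in A & y in B].
  by apply: qinf_lb; exists A => //; exists B.
by exists x, y.
Qed.

Lemma uext_mono X Y (r s : vrel V X Y) :
  vrel_le r s -> vrel_le (uext r) (uext s).
Proof.
move=> rs u v; have := @uext_umap V _ _ _ _ id id r s rs u v.
by rewrite !umap_id.
Qed.

Lemma uext_umapr X Y Z (r : vrel V X Y) (g : Z -> Y)
    (u : ultra X) (w : ultra Z) :
  uext r u (umap g w) = uext (fun x z => r x (g z)) u w.
Proof.
apply: qle_anti; last first.
  have := @uext_umap V _ _ _ _ id g (fun x z => r x (g z)) r _ u w.
  by rewrite umap_id; apply => x z; apply: qle_refl.
apply: qinf_ge => _ [A uA [B wB <-]].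
apply: qle_trans; first apply: qinf_lb.
  exists A => //; exists (g @` B) => //.
  by apply: ultraS wB => z Bz; exists z.
apply: qsup_le => _ [x Ax [_ [z Bz <-] <-]]; apply: qsup_ub.
by exists x => //; exists z.
Qed.

Lemma uext_umult X Y (r : vrel V X Y) UU VV :
  uext (uext r) UU VV ⊑ uext r (umult UU) (umult VV).
Proof.
apply: qinf_ge => _ [A uA [B vB <-]].
apply: qle_trans; first apply: qinf_lb.
  by exists (usharp A) => //; exists (usharp B).
apply: qsup_le => _ [u Au [v Bv <-]]; apply: qinf_lb.
by exists A => //; exists B.
Qed.

End Quantales.

(* [theory_ten] says that the tensor preserves limits along ultrafilters,
   [theory_lim] that the structure of [V] is the residual of these limits. *)
Record topological_theory (V : value_space) : Prop := TopologicalTheory {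
  theory_below : forall u : V, u ⊑ qsup [set v | qbelow v u];
  theory_ten : forall I (w : ultra I) (f g : I -> V) v,
    w [set i | v ⊑ f i ⊗ g i] -> v ⊑ uxi f w ⊗ uxi g w;
  theory_lim : forall u (x t : V), t ⊑ vlim V u x <-> t ⊗ uxi id u ⊑ x }.

(** * The extension [hat] of U-relations and its functoriality *)

Section Hat.
Variable V : value_space.
Hypothesis TV : topological_theory V.

Lemma qbelow_le (u w : V) : (forall v, qbelow v u -> v ⊑ w) -> u ⊑ w.
Proof.
move=> h; apply: qle_trans (theory_below TV u) _.
exact: (qsup_le (S := [set v | qbelow v u])).
Qed.

(** By [theory_below], used twice, [u] is below the join of all elements totally below some [v']
    that is totally below [u]. *)
Lemma qbelow_interp (v u : V) : qbelow v u ->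
  exists2 v', qbelow v v' & qbelow v' u.
Proof.
move=> vu.
have [|s [v' v'u sv'] vs] := vu [set s | exists2 v', qbelow v' u & qbelow s v'].
  apply: qbelow_le => v' v'u; apply: qbelow_le => s sv'.
  by apply: qsup_ub; exists v'.
exists v' => // S v'S; have [s' Ss' ss'] := sv' S v'S.
by exists s' => //; apply: qle_trans vs ss'.
Qed.

(** Converse to [uxi_uext]: whatever is totally below [uext r u v] is a lower bound of [r] on a
    large set of some coupling. *)
Lemma uext_le X Y (r : vrel V X Y) (u : ultra X) (v : ultra Y) t :
  (forall w, umap fst w = u -> umap snd w = v ->
    uxi (fun p => r p.1 p.2) w ⊑ t) -> uext r u v ⊑ t.
Proof.
move=> h; apply: qbelow_le => s /qbelow_uext /urelate_couple [w [wu wv ws]].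
exact: qle_trans (uxi_ge ws) (h _ wu wv).
Qed.

Lemma uext_comp X Y Z (r : vrel V X Y) (s : vrel V Y Z) (t : vrel V X Z) :
  (forall x y z, r x y ⊗ s y z ⊑ t x z) ->
  forall u v w, uext r u v ⊗ uext s v w ⊑ uext t u w.
Proof.
move=> rst u v w.
apply: qle_trans (qten_ler _ (theory_below TV _)) _; apply: qsup_ten_le => b bs.
rewrite qtenC.
apply: qle_trans (qten_ler _ (theory_below TV _)) _; apply: qsup_ten_le => a ar.
apply: urelate_uext => A C uA wC.
(* The image of [A] under [a ⊑ r] is a member of [v], so the second relation can start from it and a
   common [y] exists. *)
have vA := urelate_image (qbelow_uext ar) uA.
have [y [z [[x Ax axy] Cz byz]]] := qbelow_uext bs vA wC.
exists x, z; split=> //; apply: qle_trans (rst x y z).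
by rewrite qtenC; apply: qten_le.
Qed.

Definition hat X Y (r : urel V X Y) : vrel V (ultra X) (ultra Y) :=
  fun u v => qsup [set uext r UU v | UU in [set UU | umult UU = u]].

Lemma vcomp_umult X Y (r : vrel V (ultra (ultra X)) Y) u y :
  vcomp r (vconv (vgraph (@umult X))) u y
  = qsup [set r UU y | UU in [set UU | umult UU = u]].
Proof.
apply: qle_anti; apply: qsup_le.
  move=> _ [UU _ <-]; rewrite /vconv /vgraph.
  case: asboolP => [uUU|_]; last by rewrite qten0l; apply: qbot_le.
  by rewrite qten1l; apply: qsup_ub; exists UU.
move=> _ [UU uUU <-]; apply: qsup_ub; exists UU => //.
by rewrite /vconv /vgraph asboolT // qten1l.
Qed.

Lemma op_limE (X : space V) UU u : op_lim X UU u = hat (lim X) u (umult UU).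
Proof. exact: vcomp_umult. Qed.

Lemma kcompE X Y Z (s : urel V Y Z) (r : urel V X Y) :
  kcomp s r = vcomp s (hat r).
Proof.
apply/funext => u; apply/funext => z; rewrite /kcomp vcomp_umult.
apply: qle_anti; apply: qsup_le.
  move=> _ [UU uUU <-]; apply: qsup_le => _ [v _ <-].
  apply: qle_trans; last by apply: qsup_ub; exists v.
  by apply: qten_lel; apply: qsup_ub; exists UU.
move=> _ [v _ <-]; rewrite qtenC; apply: qsup_ten_le => _ [UU uUU <-].
rewrite qtenC; apply: qle_trans; last by apply: qsup_ub; exists UU.
by apply: qsup_ub; exists v.
Qed.

Lemma hat_ge X Y (r : urel V X Y) UU v : uext r UU v ⊑ hat r (umult UU) v.
Proof. by apply: qsup_ub; exists UU. Qed.

Lemma hat_upt X Y (r : urel V X Y) u y : r u y ⊑ hat r u (upt y).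
Proof.
rewrite -{2}(umult_upt u); apply: qle_trans (hat_ge _ _ _).
exact: uext_upt.
Qed.

(** [umap (@upt X) u] multiplies to [u], and [u] itself couples it with [umap f u]. *)
Lemma hat_graph X Y (r : urel V X Y) (f : X -> Y) u :
  (forall x, qunit ⊑ r (upt x) (f x)) -> qunit ⊑ hat r u (umap f u).
Proof.
move=> rf; rewrite -{1}(umult_umap_upt u); apply: qle_trans (hat_ge _ _ _).
apply: qle_trans (uxi_uext _ _ _ _); apply: uxi_ge.
by apply: ultraS (ultraT u) => x _; apply: rf.
Qed.

Lemma hat_mono X Y (r s : urel V X Y) : vrel_le r s -> vrel_le (hat r) (hat s).
Proof.
move=> rs u v; apply: qsup_le => _ [UU <- <-].
exact: qle_trans (uext_mono rs _ _) (hat_ge _ _ _).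
Qed.

Lemma hat_umapr X Y Z (r : urel V X Y) (g : Z -> Y) u w :
  hat r u (umap g w) = hat (fun u z => r u (g z)) u w.
Proof.
by rewrite /hat; congr qsup; apply: eq_imagel => UU _; rewrite uext_umapr.
Qed.

Lemma hat_umapl X X' Y (r : urel V X' Y) (f : X -> X') u w :
  hat (fun u y => r (umap f u) y) u w ⊑ hat r (umap f u) w.
Proof.
apply: qsup_le => _ [UU <- <-].
rewrite -umult_umap; apply: qle_trans (hat_ge _ _ _).
rewrite -{2}(umap_id w); apply: uext_umap => v y; exact: qle_refl.
Qed.

(* Lax functoriality of [hat] rests on the Beck-Chevalley property, oplax
   functoriality on compactness ([theory_ten]). *)
Lemma hat_lax X Y Z (r : urel V X Y) (s : urel V Y Z) (t : urel V X Z) :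
  (forall u v z, hat r u v ⊗ s v z ⊑ t u z) ->
  forall u v w, hat r u v ⊗ hat s v w ⊑ hat t u w.
Proof.
move=> rst.
have key UU VV w : uext s VV w ⊗ uext r UU (umult VV) ⊑ hat t (umult UU) w.
  apply: qle_trans (qten_ler _ (theory_below TV _)) _.
  apply: qsup_ten_le => a ar; rewrite qtenC.
  (* Beck-Chevalley trades the multiplication of [VV] for some [UUU] over [UU], to which [uext_comp]
     applies. *)
  have [UUU [UUUE aUV]] := urelate_umult (qbelow_uext ar).
  have {}aUV : a ⊑ uext (uext r) UUU VV.
    apply: urelate_uext => A B UA VB.
    have [u [v [Au Bv /urelate_uext auv]]] := aUV _ _ UA VB.
    by exists u, v.
  apply: qle_trans (qten_lel _ aUV) _.
  have rst' UU' v z : uext r UU' v ⊗ s v z ⊑ t (umult UU') z.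
    exact: qle_trans (qten_lel _ (hat_ge _ _ _)) (rst _ _ _).
  apply: qle_trans (uext_comp rst' UUU VV w) _.
  rewrite -UUUE -umult_assoc; apply: qle_trans (hat_ge _ _ _).
  rewrite -{2}(umap_id w); apply: uext_umap => *; exact: qle_refl.
move=> u v w; apply: qsup_ten_le => _ [VV vE <-]; rewrite -{}vE qtenC.
by apply: qsup_ten_le => _ [UU uE <-]; rewrite -{}uE; apply: key.
Qed.

Lemma hat_oplax X Y Z (r : urel V X Y) (s : urel V Y Z) (t : urel V X Z) :
  (forall u z, t u z ⊑ vcomp s (hat r) u z) ->
  forall u w, hat t u w ⊑ vcomp (hat s) (hat r) u w.
Proof.
move=> trs u w; apply: qsup_le => _ [UU <- <-].
(* A coupling [W] attains [d]. Where [d ⊑ t], total belowness of [c] in [d] lets a single middle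
   pair [q] attain [c] in the composite. *)
apply: qbelow_le => c /qbelow_interp [d cd].
move=> /qbelow_uext /urelate_couple [W [W1 W2 Wd]].
pose P (p : ultra X * Z) (q : ultra (ultra X) * ultra Y) :=
  umult q.1 = p.1 /\ c ⊑ uext r q.1 q.2 ⊗ s q.2 p.2.
have PE p : d ⊑ t p.1 p.2 -> exists q, P p q.
  move=> dp; have [|_ [q pE <-] cq] := cd [set uext r q.1 q.2 ⊗ s q.2 p.2
      | q in [set q : ultra (ultra X) * ultra Y | umult q.1 = p.1]].
    apply: qle_trans dp _; apply: qle_trans (trs _ _) _.
    apply: qsup_le => _ [v _ <-]; rewrite qtenC.
    apply: qsup_ten_le => _ [UU' pE <-]; rewrite qtenC.
    by apply: qsup_ub; exists (UU', v).
  by exists q.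
(* [q0] is a default value at the points where [d ⊑ t] fails, a set that [W] ignores. *)
have [p0 [dp0 _]] := ultraI Wd Wd; have [q0 _] := PE _ dp0.
have /choice [k kP] p : exists q, d ⊑ t p.1 p.2 -> P p q.
  have [/PE [q Pq]|ndp] := pselect (d ⊑ t p.1 p.2); first by exists q.
  by exists q0.
(* [umult VV] will be the middle ultrafilter; [theory_ten] splits the limit of the tensors along [W]
   into its two degrees. *)
pose UUU := umap (fst \o k) W; pose VV := umap (snd \o k) W.
have UUUE : umap (@umult X) UUU = UU.
  rewrite -W1 /UUU -umap_comp; apply: umap_near.
  by apply: ultraS Wd => p /kP [].
have cP : c ⊑ uxi (fun p => uext r (k p).1 (k p).2) W
            ⊗ uxi (fun p => s (k p).2 p.2) W.
  by apply: (theory_ten TV); apply: ultraS Wd => p /kP [].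
apply: qle_trans cP _; rewrite -UUUE umult_assoc.
apply: qle_trans; last by apply: qsup_ub; exists (umult VV).
apply: qten_le.
  apply: qle_trans (hat_ge _ _ _); apply: qle_trans (uext_umult _ _ _).
  exact: uxi_uext.
apply: qle_trans (hat_ge _ _ _); rewrite -W2.
exact: (uxi_uext s (snd \o k) snd).
Qed.

End Hat.

(** * The exponential structure on presheaves and the Yoneda lemma *)

Section Presheaves.
Variable V : value_space.
Hypothesis TV : topological_theory V.
Implicit Types X Y Z : space V.

Lemma hat_lim X u v x : hat (lim X) u v ⊗ lim X v x ⊑ lim X u x.
Proof.
rewrite qtenC; apply: qsup_ten_le => _ [UU <- <-].
by rewrite qtenC; apply: lim_mult.
Qed.

Lemma hat_lim_trans X u v w :
  hat (lim X) u v ⊗ hat (lim X) v w ⊑ hat (lim X) u w.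
Proof. by apply: (hat_lax TV) => *; apply: hat_lim. Qed.

Lemma hat_lim_graph X Y (f g : X -> Y) u : map_le f g ->
  qunit ⊑ hat (lim Y) (umap f u) (umap g u).
Proof.
move=> fg; apply: qle_trans (hat_umapl _ _ _ _).
by apply: hat_graph => x; rewrite umap_upt; apply: fg.
Qed.

Lemma hat_lim_refl X u : qunit ⊑ hat (lim X) u u.
Proof. by rewrite -{2}(umap_id u); apply: hat_graph => x; apply: lim_refl. Qed.

Lemma hat_lim_umap X Y (f : smap X Y) u v :
  hat (lim X) u v ⊑ hat (lim Y) (umap f u) (umap f v).
Proof.
rewrite hat_umapr; apply: qle_trans (hat_umapl _ _ _ _).
by apply: hat_mono => w x; apply: sfun_map.
Qed.

(** Composing with the constant structure of [one] only takes the join of [hat psi u w] over [w];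
    the inequalities not listed follow from reflexivity. *)
Lemma umodule_oneP X (psi : urel V X one) : is_umodule psi <->
  (forall u v, hat (lim X) u v ⊗ psi v tt ⊑ psi u tt) /\
  (forall u w, hat psi u w ⊑ psi u tt).
Proof.
rewrite /is_umodule !kcompE; split=> [[h1 h2]|[h1 h2]].
  split=> u v.
    by rewrite -{2}h1; apply: qsup_ub; exists v.
  by rewrite -{2}h2; apply: qsup_ub; exists v => //; rewrite qten1.
split; apply: vrel_anti => u [].
- by apply: qsup_le => _ [v _ <-].
- rewrite -kcompE; exact: kcomp_id_le.
- by apply: qsup_le => _ [w _ <-]; rewrite qten1.
- apply: (@qle_trans _ (hat psi u (upt (tt : one)))); first exact: hat_upt.
  by apply: qsup_ub; exists (upt tt) => //; rewrite qten1.
Qed.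

Lemma psh_hat X (psi : umodule X one) u v :
  hat (lim X) u v ⊗ psi v tt ⊑ psi u tt.
Proof. exact: ((umodule_oneP psi).1 (umodP psi)).1. Qed.

Lemma psh_unitary X (psi : umodule X one) u w : hat psi u w ⊑ psi u tt.
Proof. exact: ((umodule_oneP psi).1 (umodP psi)).2. Qed.

Lemma psh_eq X (phi psi : umodule X one) :
  (forall u, phi u tt = psi u tt) -> phi = psi.
Proof.
move=> h; apply: umodule_eq; apply/funext => u; apply/funext => -[]; exact: h.
Qed.

Definition psh_ev X : urel V X (umodule X one) := fun u psi => psi u tt.

(** The principal ultrafilter at [psi] is the image of the one on a point under a constant map, so
    the upper bound is [psh_unitary]. *)
Lemma hat_psh_ev_upt X u (psi : umodule X one) :
  hat (@psh_ev X) u (upt psi) = psi u tt.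
Proof.
apply: qle_anti; last exact: (hat_upt (@psh_ev X)).
rewrite -(umap_upt (fun _ : unit => psi) tt) hat_umapr.
apply: qle_trans (psh_unitary psi u (upt tt)).
by apply: hat_mono => v []; apply: qle_refl.
Qed.

Definition psh_lim X : urel V (umodule X one) (umodule X one) :=
  fun p psi => qres (fun u => hat (@psh_ev X) u p) (fun u => psi u tt).

Lemma psh_lim_is_space X : is_space (@psh_lim X).
Proof.
apply/is_spaceP; split=> [psi|PP p psi]; apply/qresP => u.
  by rewrite hat_psh_ev_upt qten1l; apply: qle_refl.
(* [psh_lim] is the largest U-relation with this property, which [hat_lax] extends to [hat]. *)
have ev_lim v q phi : hat (@psh_ev X) v q ⊗ psh_lim q phi ⊑ psh_ev v phi.
  by rewrite qtenC; apply: qres_ten.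
rewrite -qtenA qtenC -qtenA.
apply: qle_trans (qres_ten _ (fun u => psi u tt) u).
apply: qten_ler; apply: qle_trans (qten_ler _ (hat_ge _ _ _)) _.
exact: (hat_lax TV) ev_lim _ _ _.
Qed.

Lemma psh_lim_mapP X Z (h : Z -> umodule X one) :
  is_map (lim Z) (@psh_lim X) h <->
  forall z z0 u, lim Z z z0 ⊗ hat (fun u z => h z u tt) u z ⊑ h z0 u tt.
Proof.
split=> [hm z z0 u|hm z z0].
  by have /qresP/(_ u) := hm z z0; rewrite hat_umapr.
by apply/qresP => u; rewrite hat_umapr; apply: hm.
Qed.

(** By [theory_lim], a map into [V] amounts to a bound on limits along ultrafilters of the product.
    These are couplings, and [uext] is the join of the limits along couplings ([uxi_uext],
    [uext_le]). *)
Lemma psh_lim_exponential X : is_exponential_lim (@psh_lim X).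
Proof.
split=> [|Z h]; first exact: psh_lim_is_space.
rewrite psh_lim_mapP; split=> hm.
  move=> w [z0 u] /=; apply/(theory_lim TV); rewrite uxi_umap /tensor_lim /=.
  rewrite op_limE [lim Z _ _ ⊗ hat _ _ _]qtenC -qtenA.
  apply: qle_trans (psh_hat (h z0) u (umult (umap snd w))).
  apply: qten_ler; apply: qle_trans (hm (umap fst w) _ _); apply: qten_ler.
  apply: qle_trans (hat_ge _ _ _).
  exact: (uxi_uext (fun u z => h z u tt) snd fst).
move=> z z0 u; apply: qsup_ten_le => _ [UU <- <-].
(* A residual over [unit] moves [lim Z z z0] to the right, leaving [uext] alone on the left for
   [uext_le]. *)
suff : uext (fun u z => h z u tt) UU z
    ⊑ qres (fun _ : unit => lim Z z z0) (fun _ => h z0 (umult UU) tt).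
  by move=> /qresP/(_ tt); rewrite qtenC.
apply: (uext_le TV) => w wUU wz; apply/qresP => _.
have := hm (umap (fun p => (p.2, p.1)) w) (z0, umult UU).
rewrite /tensor_lim /= op_limE -!umap_comp /comp /= wUU wz.
move=> /(theory_lim TV); rewrite uxi_umap /comp /=; apply: qle_trans.
by rewrite qtenC; apply: qten_lel; rewrite -{1}(qten1 (lim Z z z0));
  apply: qten_ler; apply: hat_lim_refl.
Qed.

(** The structure was obtained by choice: existence excludes the indiscrete default and uniqueness
    makes it the explicit one. *)
Lemma presheaf_limE X : lim (presheaf X) = @psh_lim X.
Proof.
rewrite /presheaf /= /presheaf_lim; case: pselect => [h|[]] /=.
  apply: exponential_lim_unique (psh_lim_exponential X); exact: (svalP (cid h)).
by exists (@psh_lim X); apply: psh_lim_exponential.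
Qed.

Lemma psh_mapP X Z (h : Z -> presheaf X) :
  is_map (lim Z) (lim (presheaf X)) h <->
  forall z z0 u, lim Z z z0 ⊗ hat (fun u z => h z u tt) u z ⊑ h z0 u tt.
Proof. by rewrite presheaf_limE; apply: psh_lim_mapP. Qed.

Lemma psh_lim_ev X p (psi : presheaf X) u :
  lim (presheaf X) p psi ⊗ hat (@psh_ev X) u p ⊑ psi u tt.
Proof.
rewrite presheaf_limE.
exact: (qres_ten _ (fun u => (psi : umodule X one) u tt)).
Qed.

Lemma psh_leP X (phi psi : presheaf X) :
  qunit ⊑ lim (presheaf X) (upt phi) psi <-> forall u, phi u tt ⊑ psi u tt.
Proof.
rewrite presheaf_limE; split=> [/qresP h u|h].
  by have := h u; rewrite hat_psh_ev_upt qten1l.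
by apply/qresP => u; rewrite hat_psh_ev_upt qten1l.
Qed.

Lemma presheaf_T0 X : T0 (presheaf X).
Proof.
move=> phi psi /psh_leP h1 /psh_leP h2; apply: psh_eq => u.
exact: qle_anti (h1 u) (h2 u).
Qed.

(** Testing the residual at [u] itself, where [hat] is reflexive, gives one bound; the other is the
    module axiom [psh_hat]. *)
Lemma lim_yoneda X u (psi : presheaf X) :
  lim (presheaf X) (umap (yoneda X) u) psi = psi u tt.
Proof.
have evE v : hat (@psh_ev X) v (umap (yoneda X) u) = hat (lim X) v u.
  by rewrite hat_umapr.
apply: qle_anti.
  have ku := hat_lim_refl u; rewrite -evE in ku.
  apply: qle_trans (psh_lim_ev _ psi u).
  by rewrite -{1}[lim _ _ _]qten1; apply: qten_ler.
rewrite presheaf_limE; apply/qresP => v.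
by have := psh_hat psi v u; rewrite -evE qtenC.
Qed.

Lemma yoneda_is_map X : is_map (lim X) (lim (presheaf X)) (yoneda X).
Proof. by move=> u x; rewrite lim_yoneda; apply: qle_refl. Qed.

Definition yoneda_map X : smap X (presheaf X) := SMap (@yoneda_is_map X).

(** * The adjoint string [psh_push], [psh_pull], [psh_ran] of a map *)

Section Presheaf_maps.
Variables (X Y : space V) (f : smap X Y).

Lemma psh_pull_is_umodule (psi : presheaf Y) :
  is_umodule (fun u (_ : one) => psi (umap f u) tt : V).
Proof.
apply/(@umodule_oneP X); split=> u v.
  apply: qle_trans (psh_hat psi (umap f u) (umap f v)).
  by apply: qten_lel; apply: hat_lim_umap.
apply: qle_trans (psh_unitary psi (umap f u) v).
apply: qle_trans (hat_umapl _ _ _ _).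
by apply: hat_mono => w []; apply: qle_refl.
Qed.

Definition psh_pull (psi : presheaf Y) : presheaf X :=
  UModule (psh_pull_is_umodule psi).

Lemma psh_pull_is_map :
  is_map (lim (presheaf Y)) (lim (presheaf X)) psh_pull.
Proof.
apply/psh_mapP => p psi u; apply: qle_trans (psh_lim_ev p psi (umap f u)).
by apply: qten_ler; apply: (hat_umapl (@psh_ev Y)).
Qed.

Definition psh_pull_map : smap (presheaf Y) (presheaf X) :=
  SMap psh_pull_is_map.

Lemma kcomp_lower_star (psi : presheaf Y) :
  kcomp psi (lower_star f) = psh_pull psi.
Proof.
rewrite kcompE; apply: vrel_anti => u [].
  apply: qsup_le => _ [v _ <-].
  apply: qle_trans (psh_hat psi (umap f u) v).
  by apply: qten_lel; apply: hat_umapl.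
apply: qle_trans; last by apply: qsup_ub; exists (umap f u).
apply: qten_unitl; apply: hat_graph => x.
by rewrite /lower_star umap_upt; apply: lim_refl.
Qed.

(** By [hat_umapr], [hat (lim Y) v (umap f u)] is the extension of the upper star of [f]. *)
Definition psh_push_val (phi : presheaf X) : ultra Y -> V :=
  fun v => qsup [set hat (lim Y) v (umap f u) ⊗ phi u tt | u in setT].

(** [hat_oplax] for the upper star of [f]. With [phi] as [s] it makes [psh_push phi] a module, with
    [psh_ev] it makes [psh_push] a map. *)
Lemma hat_psh_push (Z : Type) (s : urel V X Z) (t : urel V Y Z) v w :
  (forall v z, t v z
    ⊑ qsup [set hat (lim Y) v (umap f u) ⊗ s u z | u in setT]) ->
  hat t v w
  ⊑ qsup [set hat (lim Y) v (umap f u) ⊗ hat s u w | u in setT].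
Proof.
move=> ts; have := hat_oplax TV (r := fun v x => lim Y v (f x)) (s := s).
move=> /(_ t) h; apply: qle_trans (h _ v w) _ => [u z|].
  apply: qle_trans (ts u z) _; apply: qsup_le => _ [x _ <-].
  by rewrite hat_umapr; apply: qsup_ub; exists x.
by apply: qsup_le => _ [x _ <-]; rewrite -hat_umapr; apply: qsup_ub; exists x.
Qed.

Lemma psh_push_is_umodule (phi : presheaf X) :
  is_umodule (fun v (_ : one) => psh_push_val phi v).
Proof.
apply/(@umodule_oneP Y); split=> u v.
  apply: qsup_ten_le => _ [w _ <-]; rewrite qtenA.
  apply: qle_trans; last by apply: qsup_ub; exists w.
  by apply: qten_lel; apply: hat_lim_trans.
apply: qle_trans (@hat_psh_push one phi _ _ _ _) _ => [w []|].
  exact: qle_refl.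
apply: qsup_le => _ [w _ <-].
apply: qle_trans; last by apply: qsup_ub; exists w.
by apply: qten_ler; apply: psh_unitary.
Qed.

Definition psh_push (phi : presheaf X) : presheaf Y :=
  UModule (psh_push_is_umodule phi).

Lemma psh_push_is_map :
  is_map (lim (presheaf X)) (lim (presheaf Y)) psh_push.
Proof.
apply/psh_mapP => p phi u.
apply: qle_trans (qten_ler _ (@hat_psh_push _ (@psh_ev X) _ _ _ _)) _ => [w z|].
  exact: qle_refl.
apply: qsup_ten_le => _ [w _ <-].
apply: qle_trans; last by apply: qsup_ub; exists w.
rewrite qtenC -qtenA; apply: qten_ler; rewrite qtenC; exact: psh_lim_ev.
Qed.

Definition psh_push_map : smap (presheaf X) (presheaf Y) :=
  SMap psh_push_is_map.

Definition psh_ran_val (phi : presheaf X) : ultra Y -> V :=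
  fun v => qres (fun u => hat (lower_star f) u v) (fun u => phi u tt).

Lemma psh_ran_is_umodule (phi : presheaf X) :
  is_umodule (fun v (_ : one) => psh_ran_val phi v).
Proof.
apply/(@umodule_oneP Y); split=> v w; apply/qresP => u.
  rewrite [hat _ _ _ ⊗ _]qtenC -qtenA.
  apply: qle_trans (qres_ten _ (fun u => phi u tt) u); apply: qten_ler.
  rewrite qtenC; apply: (hat_lax TV) => u' v' y.
  exact: qle_trans (qten_lel _ (hat_umapl _ _ _ _)) (hat_lim _ _ _).
apply: qle_trans (psh_unitary phi u w); rewrite qtenC.
apply: (hat_lax TV) => u' v' [].
by rewrite qtenC; apply: (qres_ten _ (fun u => phi u tt)).
Qed.

Definition psh_ran (phi : presheaf X) : presheaf Y :=
  UModule (psh_ran_is_umodule phi).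

Lemma psh_ran_is_map : is_map (lim (presheaf X)) (lim (presheaf Y)) psh_ran.
Proof.
apply/psh_mapP => p phi v; apply/qresP => u.
apply: qle_trans (psh_lim_ev p phi u); rewrite -qtenA; apply: qten_ler.
rewrite qtenC; apply: (hat_lax TV) => u' v' psi.
by rewrite qtenC; apply: (qres_ten _ (fun u => psi u tt)).
Qed.

Definition psh_ran_map : smap (presheaf X) (presheaf Y) := SMap psh_ran_is_map.

Lemma psh_push_pull : adj psh_push_map psh_pull_map.
Proof.
split=> [phi|psi]; apply/psh_leP => u /=.
  apply: qle_trans; last by apply: qsup_ub; exists u.
  by apply: qten_unitl; apply: hat_lim_refl.
by apply: qsup_le => _ [w _ <-]; apply: psh_hat.
Qed.

Lemma psh_pull_ran : adj psh_pull_map psh_ran_map.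
Proof.
split=> [psi|phi]; apply/psh_leP => u /=.
  apply/qresP => v; rewrite qtenC; apply: qle_trans (psh_hat psi _ u).
  by apply: qten_lel; apply: hat_umapl.
apply: qle_trans (qres_ten _ (fun u => phi u tt) u).
rewrite -{1}[psh_ran_val _ _]qten1; apply: qten_ler; apply: hat_graph => x.
by rewrite /lower_star umap_upt; apply: lim_refl.
Qed.

Lemma psh_push_yoneda x : psh_push (yoneda X x) = yoneda Y (f x).
Proof.
apply: psh_eq => v; apply: qle_anti.
  apply: qsup_le => _ [u _ <-]; apply: qle_trans (hat_lim _ (umap f u) _).
  by apply: qten_ler; apply: sfun_map.
apply: qle_trans; last by apply: qsup_ub; exists (upt x).
rewrite qtenC; apply: qle_trans (qten_unitl _ (lim_refl x)) _.
by apply: qten_ler; rewrite umap_upt; apply: (hat_upt (lim Y) v (f x)).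
Qed.

End Presheaf_maps.

Lemma psh_pull_id X psi : psh_pull (smap_id X) psi = psi.
Proof. by apply: psh_eq => u; rewrite /= umap_id. Qed.

Lemma psh_pull_comp X Y Z (g : smap Y Z) (f : smap X Y) psi :
  psh_pull (smap_comp g f) psi = psh_pull f (psh_pull g psi).
Proof. by apply: psh_eq => u; rewrite /= umap_comp. Qed.

Lemma psh_pull_anti X Y (f g : smap X Y) : map_le f g ->
  map_le (psh_pull_map g) (psh_pull_map f).
Proof.
move=> fg psi; apply/psh_leP => u /=.
apply: qle_trans (psh_hat psi (umap f u) (umap g u)).
by apply: qten_unitl; apply: hat_lim_graph.
Qed.

(** The Yoneda lemma rewrites evaluation at [u] as convergence of the image of [u], so the unit is
    the module axiom of [Psi] and the counit is an equality. *)
Lemma presheaf_sup X : adj (psh_pull_map (yoneda_map X)) (yoneda (presheaf X)).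
Proof.
split=> [Psi|psi]; apply/psh_leP => p.
  change (Psi p tt ⊑ lim (presheaf X) p (psh_pull (yoneda_map X) Psi)).
  rewrite presheaf_limE; apply/qresP => u.
  rewrite qtenC; apply: qle_trans (psh_hat Psi _ p); apply: qten_lel.
  apply: qle_trans (hat_umapl _ _ _ _); apply: hat_mono => v phi.
  by rewrite lim_yoneda; apply: qle_refl.
change (lim (presheaf X) (umap (yoneda X) p) psi ⊑ psi p tt).
by rewrite lim_yoneda; apply: qle_refl.
Qed.

Lemma presheaf_cd X : T0 (presheaf X) /\ completely_distributive (presheaf X).
Proof.
split; first exact: presheaf_T0.
have Sup := presheaf_sup X; split.
  by exists (psh_pull_map (yoneda_map X)).
exists (psh_push_map (yoneda_map X)), (psh_pull_map (yoneda_map X)).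
by split=> //; apply: psh_push_pull.
Qed.

End Presheaves.

(** * Adjoint maps and completely distributive spaces *)

Section Adjunctions.
Variable V : value_space.
Hypothesis TV : topological_theory V.
Implicit Types X Y : space V.

(** The lower star of [f] is the upper star of [g]: the unit extends to ultrafilters by
    [hat_lim_graph], and the counit is used at [y]. *)
Lemma adj_lim X Y (f : smap X Y) (g : smap Y X) u y : adj f g ->
  lim Y (umap f u) y = lim X u (g y).
Proof.
move=> [unit counit]; apply: qle_anti.
  apply: qle_trans (sfun_map g _ _) _; rewrite -umap_comp.
  apply: qle_trans (hat_lim _ (umap (g \o f) u) _); apply: qten_unitl.
  by rewrite -{1}(umap_id u); apply: hat_lim_graph.
apply: qle_trans (sfun_map f _ _) _.
apply: qle_trans (hat_lim _ (upt (f (g y))) _).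
rewrite -{1}[lim _ _ _]qten1; apply: qten_le; last exact: counit.
exact: (hat_upt (lim Y)).
Qed.

(** The chain is [f' <= f' g f <= f' g' f <= f]. *)
Lemma adj_mate X Y (f f' : smap X Y) (g g' : smap Y X) :
  adj f g -> adj f' g' -> map_le g g' -> map_le f' f.
Proof.
move=> [unit _] [_ counit] gg'.
apply: (map_le_trans (map_le_whisker f' id unit)).
apply: (map_le_trans (map_le_whisker f' f gg')).
exact: (map_le_whisker (smap_id Y) f counit).
Qed.

Lemma map_le_eq X Y (f g : X -> Y) : f =1 g -> map_le f g.
Proof. by move=> fg x; rewrite fg; apply: lim_refl. Qed.

Lemma adj_left_unique X Y (f f' : smap X Y) (g g' : smap Y X) : T0 Y ->
  adj f g -> adj f' g' -> map_le g g' -> map_le g' g -> f =1 f'.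
Proof.
move=> Y0 fg fg' gg' g'g x; apply: Y0; first exact: (adj_mate fg' fg g'g).
exact: (adj_mate fg fg' gg').
Qed.

(** The unit at [yoneda X x], evaluated at [upt x], where [yoneda X x] is the unit of [V] by
    reflexivity. *)
Lemma sup_yoneda_ge X (Sup : smap (presheaf X) X) :
  adj Sup (yoneda_map TV X) -> map_le id (Sup \o yoneda X).
Proof.
move=> [unit _] x; have /(psh_leP TV)/(_ (upt x)) := unit (yoneda X x).
by apply: qle_trans; apply: lim_refl.
Qed.

Lemma sup_yoneda X (Sup : smap (presheaf X) X) : T0 X ->
  adj Sup (yoneda_map TV X) -> cancel (yoneda X) Sup.
Proof.
move=> X0 Sy x; apply: X0; first exact: Sy.2.
exact: sup_yoneda_ge Sy x.
Qed.

Section Completely_distributive.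
Variable L : cdspace V.

Lemma cd_tP : exists Sup : smap (presheaf L) L,
  adj Sup (yoneda_map TV L) /\ adj (cd_t L) Sup.
Proof. exact: (svalP (cid (cdsp_cd L).2)). Qed.

(** [cd_t] is chosen together with some [Sup]. All left adjoints of [yoneda] are equivalent, hence
    so are their left adjoints, and presheaves are T0. *)
Lemma cd_tE (t : smap L (presheaf L)) (Sup : smap (presheaf L) L) :
  adj Sup (yoneda_map TV L) -> adj t Sup -> cd_t L =1 t.
Proof.
move=> Sy tS; have [Sup' [S'y tS']] := cd_tP.
have yy : map_le (yoneda_map TV L) (yoneda_map TV L) by apply: map_le_eq.
apply: adj_left_unique tS' tS _ _; first exact: presheaf_T0.
  exact: adj_mate Sy S'y yy.
exact: adj_mate S'y Sy yy.
Qed.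

(** The chain is [t <= t Sup y <= y]. *)
Lemma cd_t_le (x : L) u : cd_t L x u tt ⊑ lim L u x.
Proof.
have [Sup [Sy [_ counit]]] := cd_tP.
have tx : map_le (cd_t L) (yoneda L).
  apply: (map_le_trans (map_le_whisker (cd_t L) id (sup_yoneda_ge Sy))).
  exact: (map_le_whisker (smap_id (presheaf L)) (yoneda L) counit).
by have /(psh_leP TV)/(_ u) := tx x.
Qed.

Lemma cd_t_Sobj (w : ultra (Sobj L)) (x : L) :
  cd_t L x (umap (Sincl L) w) tt = lim L (umap (Sincl L) w) x.
Proof.
apply: qle_anti; first exact: cd_t_le.
(* By the Yoneda lemma the left-hand value is the convergence of the image under [yoneda] to
   [cd_t L x]; on the spectrum this image is the one under [cd_t]. *)
rewrite -(lim_yoneda TV) -umap_comp; apply: qle_trans (sfun_map (cd_t L) _ _) _.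
rewrite -umap_comp; suff -> : cd_t L \o Sincl L = yoneda L \o Sincl L.
  exact: qle_refl.
by apply/funext => -[].
Qed.

End Completely_distributive.

(** * Restriction of left adjoints to spectra *)

Section Spectrum_map.
Variables (L M : cdspace V) (f : smap L M) (g : smap M L).
Hypotheses (gf : adj g f) (fR : exists h : smap M L, adj f h).

Lemma cd_t_natural m : cd_t L (g m) = psh_push TV g (cd_t M m).
Proof.
have [h fh] := fR; have [SL [SLy tSL]] := cd_tP L.
have [SM [SMy tSM]] := cd_tP M.
(* Pulling back reverses both maps and order, so it keeps [g] on the left. *)
have pull_gf : adj (psh_pull_map TV g) (psh_pull_map TV f).
  have [unit counit] := gf; split=> phi /=; rewrite -psh_pull_comp.
    rewrite -{1}(psh_pull_id phi).
    exact: (psh_pull_anti TV (f := smap_comp g f) (g := smap_id L)).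
  rewrite -{2}(psh_pull_id phi).
  exact: (psh_pull_anti TV (f := smap_id M) (g := smap_comp f g)).
(* [R1] and [R2] agree by [adj_lim] for [f] and [h]. Taking left adjoints once shows that [f]
   commutes with suprema, taking them twice gives the claim. *)
pose R1 := smap_comp (yoneda_map TV L) h.
pose R2 := smap_comp (psh_pull_map TV f) (yoneda_map TV M).
have R12 : R1 =1 R2.
  by move=> y; apply: psh_eq => u; rewrite /= /point_star (adj_lim _ _ fh).
have A1 : adj (smap_comp f SL) R1 := adj_comp SLy fh.
have A2 : adj (smap_comp SM (psh_pull_map TV g)) R2 := adj_comp pull_gf SMy.
have B1 : adj (smap_comp (cd_t L) g) (smap_comp f SL) := adj_comp gf tSL.
have B2 : adj (smap_comp (psh_push_map TV g) (cd_t M))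
    (smap_comp SM (psh_pull_map TV g)) := adj_comp tSM (psh_push_pull TV g).
apply: (adj_left_unique (presheaf_T0 TV (X := L)) B1 B2).
  by apply: (adj_mate A2 A1); apply: map_le_eq => y; rewrite R12.
by apply: (adj_mate A1 A2); apply: map_le_eq.
Qed.

Lemma Sobj_image m : cd_t M m = yoneda M m -> cd_t L (g m) = yoneda L (g m).
Proof. by move=> tm; rewrite cd_t_natural tm psh_push_yoneda. Qed.

Definition spec_fun (a : Sobj M) : Sobj L :=
  exist _ (g (sval a)) (Sobj_image (svalP a)).

Lemma spec_is_map : is_map (lim (Sobj M)) (lim (Sobj L)) spec_fun.
Proof.
move=> u a; apply: qle_trans (sfun_map g _ _) _; rewrite /= -!umap_comp.
exact: qle_refl.
Qed.

Definition spec_map : smap (Sobj M) (Sobj L) := SMap spec_is_map.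

End Spectrum_map.

Lemma Sobj_eq (L : cdspace V) (a b : Sobj L) : Sincl L a = Sincl L b -> a = b.
Proof. by case: a b => [x xA] [y yA] /= xy; apply: eq_exist. Qed.

Definition cdD (X : space V) : cdspace V :=
  CDSpace (presheaf_cd TV X).1 (presheaf_cd TV X).2.

Definition Dmap X Y (f : smap X Y) : cdmap (cdD Y) (cdD X) :=
  @CDMap _ (cdD Y) (cdD X) (psh_pull_map TV f)
    (ex_intro _ (psh_push_map TV f) (psh_push_pull TV f))
    (ex_intro _ (psh_ran_map TV f) (psh_pull_ran TV f)).

Section Smap.
Variables (L M : cdspace V) (f : cdmap L M).

Definition cd_left : smap M L := sval (cid (cdfun_left f)).

Lemma cd_leftP : adj cd_left f.
Proof. exact: (svalP (cid (cdfun_left f))). Qed.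

Definition Smap : smap (Sobj M) (Sobj L) :=
  spec_map cd_leftP (cdfun_right f).

(** [Smap] uses a chosen left adjoint; since [L] is T0, any other agrees with it. *)
Lemma SmapE (g : smap M L) a : adj g f -> Sincl L (Smap a) = g (Sincl M a).
Proof.
move=> gf; have ff : map_le f f by apply: map_le_eq.
exact: (adj_left_unique (@cdsp_T0 _ L) cd_leftP gf ff ff (Sincl M a)).
Qed.

End Smap.

Lemma cd_t_cdD X (psi : cdD X) :
  cd_t (cdD X) psi = psh_push TV (yoneda_map TV X) psi.
Proof.
exact: (@cd_tE (cdD X) (psh_push_map TV (yoneda_map TV X)) _
  (presheaf_sup TV X) (psh_push_pull TV (yoneda_map TV X))).
Qed.

(** * The unit and the counit *)

Section Unit.
Variable X : space V.

Lemma yoneda_Sobj x :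
  cd_t (cdD X) (yoneda X x) = yoneda (presheaf X) (yoneda X x).
Proof. by rewrite cd_t_cdD psh_push_yoneda. Qed.

Definition eta_fun (x : X) : Sobj (cdD X) :=
  exist _ (yoneda X x) (yoneda_Sobj x).

Lemma eta_is_map : is_map (lim X) (lim (Sobj (cdD X))) eta_fun.
Proof.
by move=> u x; rewrite /= -umap_comp; apply: yoneda_is_map.
Qed.

Definition eta_map : smap X (Sobj (cdD X)) := SMap eta_is_map.

End Unit.

Section Counit.
Variable L : cdspace V.

Definition eps_smap : smap L (cdD (Sobj L)) :=
  smap_comp (psh_pull_map TV (Sincl L)) (yoneda_map TV L).

Lemma eps_smapE : eps_smap = smap_comp (psh_pull_map TV (Sincl L)) (cd_t L).
Proof.
apply: smap_eq; apply/funext => x; apply: psh_eq => w; apply/esym.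
exact: cd_t_Sobj.
Qed.

Lemma eps_left (Sup : smap (presheaf L) L) : adj Sup (yoneda_map TV L) ->
  adj (smap_comp Sup (psh_push_map TV (Sincl L))) eps_smap.
Proof. exact: (adj_comp (psh_push_pull TV (Sincl L))). Qed.

Lemma eps_right (Sup : smap (presheaf L) L) : adj (cd_t L) Sup ->
  adj eps_smap (smap_comp Sup (psh_ran_map TV (Sincl L))).
Proof.
rewrite eps_smapE => tS; exact: (adj_comp tS (psh_pull_ran TV (Sincl L))).
Qed.

Definition eps_map : cdmap L (cdD (Sobj L)).
Proof.
apply: (@CDMap _ L (cdD (Sobj L)) eps_smap); have [Sup [Sy tS]] := cd_tP L.
- by exists (smap_comp Sup (psh_push_map TV (Sincl L))); apply: eps_left.
- by exists (smap_comp Sup (psh_ran_map TV (Sincl L))); apply: eps_right.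
Defined.

End Counit.

End Adjunctions.

(** * The two cases satisfy the axioms of [topological_theory] *)

Lemma topological_is_theory : topological_theory topological.
Proof.
have ge_true I (f : I -> bool_quantale) (w : ultra I) :
    w [set i | f i] -> uxi f w = true.
  by move=> wf; apply: (@uxi_ge bool_quantale _ f w true wf).
split.
- case=> //=; apply: (@qsup_ub bool_quantale _ true) => S /= St.
  by exists true => //; apply/asboolP.
- move=> I w f g [] // wfg; change (is_true (uxi f w && uxi g w)).
  by rewrite !ge_true //; apply: ultraS wfg => i /= /andP[].
- move=> u x [] //; change (sierpinski_lim u x <-> (uxi id u ==> x)).
  have -> : sierpinski_lim u x = (uxi id u ==> x); last by split.
  apply/asboolP/idP => [ux|/implyP ux O [->|[->|->]]] //=; last 2 first.
  (* A member of [u] that misses [false] would make the limit of the identity [true], which excludes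
     [x = false]. *)
  + case: x ux => // ux _; apply: ultra_meet => A uA.
    apply: contrapT => A0; suff : uxi id u by move/ux.
    apply: ge_true; apply: ultraS uA => -[] //= Af.
    by case: A0; exists false.
  + by move=> _; apply: ultraT.
  apply/implyP => uu; case: x ux => // /(_ [set false]) uf.
  have {}uf : u [set false] by apply: uf => //; right; left.
  have /implyP/(_ uu)/asboolP [_ ->] // :
      uxi id u ==> qsup ([set id i | i in [set false]] : set bool_quantale).
  by apply: (@qinf_lb bool_quantale); exists [set false].
Qed.

Section Approach_theory.
Variable R : realType.
Local Open Scope ereal_scope.
Local Notation Q := (nn_quantale R).

(** Numerically [x] is added to a supremum: if [v] is finite then so is [x], which can be
    subtracted. An empty [S] would have supremum 0 and leave [x] unbounded. *)
Lemma nn_ten_inf (S : set Q) (x v : Q) : S !=set0 ->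
  (forall y, S y -> (v ⊑ y ⊗ x)%Q) -> (v ⊑ qinf S ⊗ x)%Q.
Proof.
move=> [y0 Sy0] h /=; case: v h => [[r| |] // v0] /= h; last exact: leey.
have x_fin : sval x \is a fin_num.
  rewrite ge0_fin_numE ?(svalP x) //; apply: le_lt_trans (ltry r).
  by apply: le_trans (h _ Sy0); apply: leeDr; apply: (svalP y0).
rewrite -leeBrDr // ge_max; apply/andP; split.
  rewrite leeBrDr // add0e; apply: le_trans (h _ Sy0).
  by apply: leeDr; apply: (svalP y0).
by apply: ge_ereal_sup => _ [y Sy <-]; rewrite leeBrDr //; apply: h.
Qed.

(** The maximum with 0 in [qinf] changes nothing, as the member [setT] already contributes a
    nonnegative infimum. *)
Lemma nn_uxi (u : ultra Q) : sval (uxi id u : Q) = nn_xi u.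
Proof.
have xi_ge0 : 0 <= nn_xi u.
  apply: (@le_trans _ _ (ereal_inf [set sval v | v in [set: Q]])).
    by apply: le_ereal_inf_tmp => _ [v _ <-]; apply: (svalP v).
  by apply: ereal_sup_ubound; exists setT => //; apply: ultraT.
rewrite -[RHS](max_r xi_ge0) /=; congr maxe; congr ereal_sup.
rewrite image_comp; apply: eq_imagel => A _ /=.
by rewrite image_id.
Qed.

Lemma approach_is_theory : topological_theory (approach R).
Proof.
split.
(* Numerically larger elements are totally below [u]; for finite [u] the elements [r + e]
   suffice. *)
- move=> u /=; have lt_below (v : Q) : sval u < sval v -> qbelow v (u : Q).
    move=> uv S /= Su.
    have [|_ [s Ss <-] sv] := @ereal_inf_lt _ [set sval v | v in S] (sval v).
      exact: le_lt_trans uv.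
    by exists s => //; apply: ltW.
  case: u lt_below => [[r| |] // r0] /= lt_below; last exact: leey.
  apply/lee_addgt0Pr => e e0; have re0 : 0 <= r%:E + e%:E.
    by apply: adde_ge0 => //; rewrite lee_fin ltW.
  apply: ereal_inf_lbound; exists (nnmk re0) => //; apply: lt_below => /=.
  by rewrite -EFinD lte_fin ltrDl.
- move=> I w f g v wv; have I0 : uset w !=set0 by exists setT; apply: ultraT.
  (* The two limits are removed one after the other, leaving a point common to [A], [B] and the
     given large set. *)
  apply: (@nn_ten_inf _ _ v).
    by case: I0 => A wA; exists (qsup [set f i | i in A]), A.
  move=> _ [A wA <-]; rewrite qtenC.
  apply: (@nn_ten_inf _ _ v).
    by case: I0 => B wB; exists (qsup [set g i | i in B]), B.
  move=> _ [B wB <-]; have [i [[Ai Bi] vi]] := ultraI (ultra_setI wA wB) wv.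
  apply: qle_trans vi _; rewrite qtenC.
  by apply: qten_le; apply: qsup_ub; exists i.
- move=> u x t; change (maxe (sval x - nn_xi u) 0 <= sval t <->
    sval x <= sval t + sval (uxi id u : Q)).
  rewrite nn_uxi; have := svalP (uxi id u : Q); rewrite nn_uxi.
  rewrite ge_max (svalP t) andbT; case: (nn_xi u) => [r| |] // _.
    by rewrite leeBlDr.
  (* Here [nn_xi u] is infinite, and both sides hold for every [t]. *)
  rewrite addeNy leNye addey ?leey //.
  by apply: contraTneq (svalP t) => ->.
Qed.

End Approach_theory.

(** * Functors, natural transformations and triangle identities *)

Section Duality.
Variable V : value_space.
Hypothesis TV : topological_theory V.

Definition D_functor : functor_on (Dobj (presheaf_cd TV)).
Proof.
apply: (@FunctorOn (op (Sp V)) (CDSp V) _ (fun X Y f => Dmap TV f)).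
- by move=> X; apply: cdmap_eq; apply/funext => psi; apply: psh_pull_id.
- move=> X Y Z g f; apply: cdmap_eq; apply/funext => psi; exact: psh_pull_comp.
Defined.

Definition S_functor : functor_on (@Sobj V).
Proof.
apply: (@FunctorOn (CDSp V) (op (Sp V)) _ (fun L M f => Smap TV f)).
- move=> L; apply: smap_eq; apply/funext => a; apply: Sobj_eq.
  by rewrite (SmapE _ _ (g := smap_id L)) //; apply: adj_id.
- move=> L M N g f; apply: smap_eq; apply/funext => a; apply: Sobj_eq.
  rewrite (SmapE _ _ (g := smap_comp (cd_left f) (cd_left g))) //.
  exact: adj_comp (cd_leftP g) (cd_leftP f).
Defined.

Definition eta_nat :
  nat_trans (functor_comp S_functor D_functor) (functor_id (op (Sp V))).
Proof.
apply: (@NatTrans _ _ _ _ (functor_comp S_functor D_functor)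
  (functor_id (op (Sp V))) (eta_map TV)) => X Y f.
apply: smap_eq; apply/funext => y; apply: Sobj_eq.
(* [psh_push] is left adjoint to [psh_pull], so [S (D f)] restricts it, and naturality of [yoneda]
   remains. *)
have SDf := @SmapE _ TV (cdD TV X) (cdD TV Y) (Dmap TV f) (psh_push_map TV f)
  (eta_map TV Y y) (psh_push_pull TV f).
exact: etrans SDf (psh_push_yoneda TV f y).
Defined.

Definition eps_nat :
  nat_trans (functor_id (CDSp V)) (functor_comp D_functor S_functor).
Proof.
apply: (@NatTrans _ _ _ _ (functor_id (CDSp V))
  (functor_comp D_functor S_functor) (eps_map TV)) => L M f.
apply: cdmap_eq; apply/funext => x; apply: psh_eq => w.
(* Convergence to [f x] is convergence to [x] of the image under the left adjoint of [f], which
   restricts to [Smap]. *)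
rewrite /= /point_star -(adj_lim _ _ (cd_leftP f)) -!umap_comp.
exact: erefl.
Defined.

Lemma S_eps_eta (L : cdspace V) :
  smap_comp (Smap TV (eps_map TV L)) (eta_map TV (Sobj L)) = smap_id (Sobj L).
Proof.
have [Sup [Sy _]] := cd_tP TV L.
apply: smap_eq; apply/funext => a; apply: Sobj_eq.
(* With the left adjoint of [eps_left], the composite sends [a] to [Sup (yoneda L a)], which is [a]
   by [sup_yoneda]. *)
have SepsE := @SmapE _ TV L (cdD TV (Sobj L)) (eps_map TV L) _
  (eta_map TV (Sobj L) a) (eps_left Sy).
apply: etrans SepsE _; rewrite /= psh_push_yoneda.
exact: sup_yoneda (@cdsp_T0 _ L) Sy _.
Qed.

Lemma D_eta_eps (X : space V) :
  cdmap_comp (Dmap TV (eta_map TV X)) (eps_map TV (cdD TV X))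
  = cdmap_id (cdD TV X).
Proof.
apply: cdmap_eq; apply/funext => psi; apply: psh_eq => u.
(* The value at [u] is the convergence to [psi] of the image of [u] under [yoneda]. *)
rewrite /= /point_star -!umap_comp; exact: (lim_yoneda TV).
Qed.

End Duality.

Theorem theorem6p1 (R : realType) (V : value_space)
    (hV : V = topological \/ V = approach R) :
  exists (HD : forall X : space V,
            T0 (presheaf X) /\ completely_distributive (presheaf X))
    (D : functor_on (Dobj HD))
    (S : functor_on (@Sobj V))
    (* eta goes from the identity to SD in Sp V, that is, from SD to the
       identity in its opposite *)
    (eta : nat_trans (functor_comp S D) (functor_id (op (Sp V))))
    (eps : nat_trans (functor_id (CDSp V)) (functor_comp D S)),
    (forall (X Y : space V) (f : smap X Y) (psi : presheaf Y),
        umod ((fmor D (A := Y) (B := X) f : cdmap _ _) psi)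
        = kcomp psi (lower_star f)) /\
    (forall (L M : cdspace V) (f : cdmap L M) (g : smap M L),
        adj g f ->
        forall a : Sobj M,
          Sincl L ((fmor S (A := L) (B := M) f : smap (Sobj M) (Sobj L)) a)
          = g (Sincl M a)) /\
    (forall (X : space V) (x : X),
        Sincl (Dobj HD X) ((eta X : smap X _) x) = yoneda X x) /\
    (forall (L : cdspace V) (x : L),
        umod ((eps L : cdmap L _) x)
        = kcomp (point_star x) (lower_star (Sincl L))) /\
    (forall L : cdspace V,
        smap_comp (fmor S (eps L)) (eta (Sobj L)) = smap_id (Sobj L)) /\
    (forall X : space V,
        cdmap_comp (fmor D (eta X)) (eps (Dobj HD X)) = cdmap_id (Dobj HD X)).
Proof.
have TV : topological_theory V.
  case: hV => ->; [exact: topological_is_theory|exact: approach_is_theory].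
exists (presheaf_cd TV), (D_functor TV), (S_functor TV), (eta_nat TV).
exists (eps_nat TV).
split; [|split; [|split; [|split; [|split]]]].
- by move=> X Y f psi; rewrite kcomp_lower_star.
- by move=> L M f g gf a; apply: SmapE.
- by [].
- move=> L x; exact: (esym (kcomp_lower_star (Sincl L) (yoneda L x))).
- exact: S_eps_eta.
- exact: D_eta_eps.
Qed.
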